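(* Let $\mathcal O$ be a dg operad and $(V,d)$ a dg vector space. Then the set of $\hat{\mathcal O}$ algebra structures on $(V,d)$ is in one-to-one correspondence with the set of $\mathcal O$ algebra structures on $(V,d')$ where $d'$ is any differential on $V$ (that is, with the set of pairs consisting of a differential $d'$ on the graded vector space $V$ and an $\mathcal O$ algebra structure on $(V,d')$).
   Context: $\mathbf k$ is a field of characteristic $0$; vector spaces are $\mathbb Z/2$-graded, dg means differential $\mathbb Z/2$-graded, $\Pi$ is parity reversion. Operads are non-unital with partial compositions $\circ_i$. An $\mathcal O$ algebra structure on a dg vector space $V$ is a map of dg operads from $\mathcal O$ to the endomorphism operad $\mathcal E(\Pi V)$, $\mathcal E(W)(n)=\mathrm{Hom}(W^{\otimes n},W)$. For a dg operad $\mathcal P$ and an MC element $m\in\mathcal P(1)$ (odd, $d(m)+m\circ_1m=0$), $\mathcal P^m$ is the operad $\mathcal P$ with differential $d+\delta_m$, where $\delta_m(z)=m\circ_1z-(-1)^{|z|}\sum_{i=1}^nz\circ_im$ for $z\in\mathcal P(n)$. $\mathcal O[m]$ is the operad generated freely by $\mathcal O$ and an odd element $m$ of arity $1$, with the differential for which $\mathcal O$ is a dg suboperad and $d(m)=-m\circ_1m$. $\hat{\mathcal O}:=(\mathcal O[m])^m$. *)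

(* Defs.v *)
From HB Require Import structures.
From mathcomp Require Import all_boot fingroup perm ssralg generic_quotient.
From mathcomp Require Import boolp functions zify.

Set Implicit Arguments.
Unset Strict Implicit.
Unset Printing Implicit Defensive.

Import GRing.Theory.
Local Open Scope ring_scope.

(* A Z/2-graded vector space over k is a family [V : bool -> lmodType k]; the
   index [false] is even and [true] is odd, and degrees add with [addb]. *)

(* Operads are symmetric, with components in all arities n >= 0.  A partial
   composition takes proofs of [r.+1 = n + m] and [s = p (+) q] instead of
   landing in [P (n + m).-1 (p (+) q)], so that no axiom needs a transport. *)
Record opStruct (k : fieldType) := OpStruct {
  op_sp :> nat -> bool -> lmodType k;
  op_comp : forall n m r p q s, 'I_n -> r.+1 = (n + m)%N -> s = p (+) q ->
    op_sp n p -> op_sp m q -> op_sp r s;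
  op_act : forall n p, 'S_n -> op_sp n p -> op_sp n p }.

Arguments op_comp {k P n m r p q s} i er es x y : rename.
Arguments op_act {k P n p} s x : rename.

(* The position, among the inputs of x \circ_i y with y of arity m, of the
   input j != i of x; the input l of y has position i + l. *)
Definition outer (m i j : nat) : nat := if (j < i)%N then j else (j + m).-1.

(* [u] is the block permutation s \circ_i t.  [op_act s] moves the input j to
   the position [s j]; it is a right action, as [(s * t) j = t (s j)]. *)
Definition block_perm (n m r : nat) (i : 'I_n) (s : 'S_n) (t : 'S_m)
    (u : 'S_r) : Prop :=
  (forall (l : 'I_m) (a : 'I_r), a = (i + l)%N :> nat ->
     u a = (s i + t l)%N :> nat) /\
  (forall (j : 'I_n) (a : 'I_r), j != i -> a = outer m i j :> nat ->
     u a = outer m (s i) (s j) :> nat).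

Record operad_axioms (k : fieldType) (P : opStruct k) : Prop := OperadAxioms {
  comp_linl : forall n m r p q s (i : 'I_n) (er : r.+1 = (n + m)%N)
      (es : s = p (+) q) (y : P m q),
    linear (fun x : P n p => op_comp i er es x y);
  comp_linr : forall n m r p q s (i : 'I_n) (er : r.+1 = (n + m)%N)
      (es : s = p (+) q) (x : P n p),
    linear (fun y : P m q => op_comp i er es x y);
  act_lin : forall n p (s : 'S_n), linear (fun x : P n p => op_act s x);
  act_1 : forall n p (x : P n p), op_act 1%g x = x;
  act_M : forall n p (s t : 'S_n) (x : P n p),
    op_act (s * t)%g x = op_act t (op_act s x);
  comp_seq : forall n m l r1 r2 r p q t s1 s2 s
      (i : 'I_n) (j : 'I_m) (h : 'I_r1)
      (er1 : r1.+1 = (n + m)%N) (es1 : s1 = p (+) q)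
      (er : r.+1 = (r1 + l)%N) (es : s = s1 (+) t)
      (er2 : r2.+1 = (m + l)%N) (es2 : s2 = q (+) t)
      (er' : r.+1 = (n + r2)%N) (es' : s = p (+) s2)
      (x : P n p) (y : P m q) (z : P l t),
    h = (i + j)%N :> nat ->
    op_comp h er es (op_comp i er1 es1 x y) z =
    op_comp i er' es' x (op_comp j er2 es2 y z);
  comp_par : forall n m l r1 r2 r p q t s1 s2 s
      (i j : 'I_n) (h : 'I_r1) (h' : 'I_r2)
      (er1 : r1.+1 = (n + m)%N) (es1 : s1 = p (+) q)
      (er : r.+1 = (r1 + l)%N) (es : s = s1 (+) t)
      (er2 : r2.+1 = (n + l)%N) (es2 : s2 = p (+) t)
      (er' : r.+1 = (r2 + m)%N) (es' : s = s2 (+) q)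
      (x : P n p) (y : P m q) (z : P l t),
    (i < j)%N -> h = outer m i j :> nat -> h' = i :> nat ->
    op_comp h er es (op_comp i er1 es1 x y) z =
    (-1) ^+ (q && t) *: op_comp h' er' es' (op_comp j er2 es2 x z) y;
  comp_act : forall n m r p q e (i : 'I_n) (er : r.+1 = (n + m)%N)
      (es : e = p (+) q) (s : 'S_n) (t : 'S_m) (u : 'S_r)
      (x : P n p) (y : P m q),
    block_perm i s t u ->
    op_comp (s i) er es (op_act s x) (op_act t y) =
    op_act u (op_comp i er es x y) }.

Record dgStruct (k : fieldType) := DgStruct {
  dg_op :> opStruct k;
  dg_d : forall n p, dg_op n p -> dg_op n (~~ p) }.

Arguments dg_d {k P n p} x : rename.

Record dg_axioms (k : fieldType) (P : dgStruct k) : Prop := DgAxioms {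
  d_lin : forall n p, linear (@dg_d k P n p);
  d_sq : forall n p (x : P n p), dg_d (dg_d x) = 0;
  d_comp : forall n m r p q s (i : 'I_n) (er : r.+1 = (n + m)%N)
      (es : s = p (+) q) (esl : ~~ s = ~~ p (+) q) (esr : ~~ s = p (+) ~~ q)
      (x : P n p) (y : P m q),
    dg_d (op_comp i er es x y) =
    op_comp i er esl (dg_d x) y + (-1) ^+ p *: op_comp i er esr x (dg_d y);
  d_act : forall n p (s : 'S_n) (x : P n p),
    dg_d (op_act s x) = op_act s (dg_d x) }.

Record dgOperad (k : fieldType) := DgOperad {
  dgo_struct :> dgStruct k;
  dgo_operad : operad_axioms dgo_struct;
  dgo_dg : dg_axioms dgo_struct }.

Record dgop_map (k : fieldType) (P Q : dgStruct k)
    (f : forall n p, P n p -> Q n p) : Prop := DgopMap {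
  map_lin : forall n p, linear (f n p);
  map_comp : forall n m r p q s (i : 'I_n) (er : r.+1 = (n + m)%N)
      (es : s = p (+) q) (x : P n p) (y : P m q),
    f r s (op_comp i er es x y) = op_comp i er es (f n p x) (f m q y);
  map_act : forall n p (s : 'S_n) (x : P n p),
    f n p (op_act s x) = op_act s (f n p x);
  map_d : forall n p (x : P n p), f n (~~ p) (dg_d x) = dg_d (f n p x) }.

Record differential (k : fieldType) (V : bool -> lmodType k) := Differential {
  diff_fun :> forall p, V p -> V (~~ p);
  diff_lin : forall p, linear (@diff_fun p);
  diff_sq : forall p (x : V p), diff_fun (diff_fun x) = 0 }.

Lemma diffN (k : fieldType) (V : bool -> lmodType k) (d : differential V) p
  (x : V p) : d p (- x) = - d p x.
Proof.
have d0 : d p 0 = 0.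
  by have := @diff_lin _ _ d p (-1) 0 0; rewrite scaler0 addr0 scaleN1r addNr.
by have := @diff_lin _ _ d p (-1) x 0; rewrite d0 !addr0 !scaleN1r.
Qed.

Section Endomorphism.
Variables (k : fieldType) (W : bool -> lmodType k).

Definition tot : lmodType k := (W false * W true)%type.

Definition proj (q : bool) (x : tot) : tot :=
  if q then (0, x.2) else (x.1, 0).

Definition homog (q : bool) (x : tot) : Prop := proj q x = x.

(* x |-> (-1)^(q |x|) x *)
Definition ksgn (q : bool) (x : tot) : tot := (x.1, (-1) ^+ q *: x.2).

Definition upd n (v : {ffun 'I_n -> tot}) (i : 'I_n) (x : tot) :
    {ffun 'I_n -> tot} := [ffun j => if j == i then x else v j].

Definition multilinear n (f : {ffun 'I_n -> tot} -> tot) : Prop :=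
  forall i v, linear (fun x : tot => f (upd v i x)).

Definition has_parity n (p : bool) (f : {ffun 'I_n -> tot} -> tot) : Prop :=
  forall (q : {ffun 'I_n -> bool}) (v : {ffun 'I_n -> tot}),
    (forall i, homog (q i) (v i)) ->
    homog (p (+) \big[addb/false]_(i < n) q i) (f v).

Definition is_end n p (f : {ffun 'I_n -> tot} -> tot) : bool :=
  `[< multilinear f /\ has_parity p f >].

(* The part of degree p of Hom(W^{\otimes n}, W), as multilinear maps on the
   total space [tot]. *)
Record endo n p := Endo {
  endo_fun :> {ffun 'I_n -> tot} -> tot;
  endo_axiom : is_end p endo_fun }.

HB.instance Definition _ n p := [isSub for @endo_fun n p].
HB.instance Definition _ n p := [Choice of endo n p by <:].

Lemma proj_linear q : linear (proj q).
Proof.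
by move=> c x y; case: q; congr pair; rewrite /= ?scaler0 ?addr0.
Qed.
HB.instance Definition _ q :=
  GRing.isLinear.Build k tot tot *:%R (proj q) (proj_linear q).

Lemma ksgn_linear q : linear (ksgn q).
Proof.
move=> c x y; congr pair.
by rewrite /= scalerDr !scalerA mulrC.
Qed.
HB.instance Definition _ q :=
  GRing.isLinear.Build k tot tot *:%R (ksgn q) (ksgn_linear q).

Lemma homog0 q : homog q 0.
Proof. by rewrite /homog linear0. Qed.

Lemma homogP q c x y : homog q x -> homog q y -> homog q (c *: x + y).
Proof. by rewrite /homog linearP /= => -> ->. Qed.

Lemma homogD q x y : homog q x -> homog q y -> homog q (x + y).
Proof. by rewrite /homog linearD /= => -> ->. Qed.

Lemma homogZ q c x : homog q x -> homog q (c *: x).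
Proof. by rewrite /homog linearZ /= => ->. Qed.

Lemma homog_sum q (I : finType) (F : I -> tot) :
  (forall i, homog q (F i)) -> homog q (\sum_i F i).
Proof.
by move=> h; rewrite /homog linear_sum; apply: eq_bigr => i _; apply: h.
Qed.

Lemma homog_ksgn q e x : homog q x -> homog q (ksgn e x).
Proof.
case: x => a b; rewrite /homog /proj /ksgn /=.
by case: q => -[<-]; rewrite /= ?scaler0.
Qed.

Lemma homog_proj q e x : homog e x -> homog e (proj q x).
Proof.
case: x => a b; rewrite /homog /proj /=.
by case: e => -[<-]; case: q.
Qed.

Lemma is_end_submod n p : submod_closed (@is_end n p).
Proof.
split.
  apply/asboolP; split; first by move=> i v c x y /=; rewrite scaler0 addr0.
  by move=> q v _; apply: homog0.
move=> c f g /asboolP[fl fp] /asboolP[gl gp]; apply/asboolP; split.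
  move=> i v a x y /=; rewrite fctE /=.
  change (c *: f (upd v i (a *: x + y)) + g (upd v i (a *: x + y)) =
    a *: (c *: f (upd v i x) + g (upd v i x)) +
    (c *: f (upd v i y) + g (upd v i y))).
  rewrite fl gl !scalerDr !scalerA (mulrC c a) -!addrA; congr (_ + _).
  by rewrite addrCA.
by move=> q v h; apply: homogP; [apply: fp|apply: gp].
Qed.
HB.instance Definition _ n p :=
  GRing.SubChoice_isSubLmodule.Build k _ _ (endo n p)
    (GRing.submod_closed_semi (is_end_submod n p)).

Lemma endo_mult n p (f : endo n p) : multilinear f.
Proof. by have /asboolP[] := endo_axiom f. Qed.

Lemma endo_par n p (f : endo n p) : has_parity p f.
Proof. by have /asboolP[] := endo_axiom f. Qed.

(* [vat v a] is the a-th argument of v; [vat] and [qat] take a natural number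
   so that the arguments of a composite are indexed without casts. *)
Definition vat r (v : {ffun 'I_r -> tot}) (a : nat) : tot :=
  oapp v 0 (insub a).

Definition comp_arg n m r (i : 'I_n) (q : bool)
    (g : {ffun 'I_m -> tot} -> tot) (v : {ffun 'I_r -> tot}) :
    {ffun 'I_n -> tot} :=
  [ffun j : 'I_n => if (j < i)%N then ksgn q (vat v j)
     else if j == i then g [ffun l : 'I_m => vat v (i + l)]
     else vat v (outer m i j)].

(* (f \circ_i g)(v_1, ..) = (-1)^(|g| (|v_1| + .. + |v_{i-1}|))
     f (v_1, .., v_{i-1}, g (v_i, ..), ..) *)
Definition comp_fun n m r (i : 'I_n) (q : bool)
    (f : {ffun 'I_n -> tot} -> tot) (g : {ffun 'I_m -> tot} -> tot)
    (v : {ffun 'I_r -> tot}) : tot :=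
  f (comp_arg i q g v).

(* The sign of the permutation s on arguments v_j of degree q j. *)
Definition koszul n (s : 'S_n) (q : {ffun 'I_n -> bool}) : k :=
  \prod_(a < n) \prod_(b < n | (a < b)%N && (s b < s a)%N)
    (-1) ^+ (q (s a) && q (s b)).

(* (f s)(v) = koszul s |v| f (v o s) on homogeneous arguments. *)
Definition act_fun n (s : 'S_n) (f : {ffun 'I_n -> tot} -> tot)
    (v : {ffun 'I_n -> tot}) : tot :=
  \sum_(q : {ffun 'I_n -> bool})
    koszul s q *: f [ffun j => proj (q (s j)) (v (s j))].

Variable D : differential W.

Definition tot_d (x : tot) : tot := (D true x.2, D false x.1).

Definition d_arg n (i : 'I_n) (v : {ffun 'I_n -> tot}) : {ffun 'I_n -> tot} :=
  [ffun j : 'I_n => if (j < i)%N then ksgn true (v j)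
     else if j == i then tot_d (v j) else v j].

(* D o f - (-1)^|f| f o (sum of 1 (x) .. (x) D (x) .. (x) 1) *)
Definition d_fun n (p : bool) (f : {ffun 'I_n -> tot} -> tot)
    (v : {ffun 'I_n -> tot}) : tot :=
  tot_d (f v) - (-1) ^+ p *: \sum_(i < n) f (d_arg i v).

Lemma multilinear_comp n r (f : {ffun 'I_n -> tot} -> tot)
    (u : {ffun 'I_r -> tot} -> {ffun 'I_n -> tot}) :
  multilinear f ->
  (forall i v, exists j, exists2 h : tot -> tot, linear h &
     forall x, u (upd v i x) = upd (u v) j (h x)) ->
  multilinear (f \o u).
Proof.
move=> fl hu i v c x y /=; have [j [h hl hE]] := hu i v.
by rewrite !hE hl fl.
Qed.

Lemma vat_upd r (v : {ffun 'I_r -> tot}) (i : 'I_r) x a :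
  vat (upd v i x) a = if a == i :> nat then x else vat v a.
Proof.
rewrite /vat; case: insubP => [b _ ba|] /=; first by rewrite ffunE -ba.
by case: eqP => // ->; rewrite ltn_ord.
Qed.


Lemma comp_fun_mult n m r (i : 'I_n) q f g : r.+1 = (n + m)%N ->
  multilinear f -> multilinear g -> multilinear (@comp_fun n m r i q f g).
Proof.
move=> er fl gl; apply: (multilinear_comp fl) => a v.
have [ai|ia] := ltnP a i.
  exists (Ordinal (ltn_trans ai (ltn_ord i))), (ksgn q).
    exact: ksgn_linear.
  move=> x; apply/ffunP => j; rewrite !ffunE -!val_eqE /=.
  case: ltnP => [ji|ij]; first by rewrite vat_upd; case: eqP.
  have -> : (j == a :> nat) = false by lia.
  case: eqP => ji.
    congr g; apply/ffunP => l; rewrite !ffunE vat_upd.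
    by have -> : (i + l == a)%N = false by lia.
  rewrite vat_upd /outer; have -> : (j < i)%N = false by lia.
  by have -> : ((j + m).-1 == a)%N = false by lia.
have [aim|ima] := ltnP a (i + m).
  have lm : (a - i < m)%N by lia.
  exists i, (fun x => g (upd [ffun l : 'I_m => vat v (i + l)] (Ordinal lm) x)).
    by move=> c x y; rewrite gl.
  move=> x; apply/ffunP => j; rewrite !ffunE -!val_eqE /=.
  case: ltnP => [ji|ij].
    rewrite vat_upd; have -> : (j == a :> nat) = false by lia.
    by have -> : (j == i :> nat) = false by lia.
  case: eqP => ji.
    congr g; apply/ffunP => l; rewrite !ffunE vat_upd -val_eqE /=.
    by have -> : (i + l == a)%N = (l == (a - i)%N :> nat) by lia.
  rewrite vat_upd /outer; have -> : (j < i)%N = false by lia.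
  by have -> : ((j + m).-1 == a)%N = false by lia.
have an : (a.+1 - m < n)%N by have := ltn_ord a; lia.
exists (Ordinal an), idfun; first by [].
move=> x; apply/ffunP => j; rewrite !ffunE -!val_eqE /=.
case: ltnP => [ji|ij].
  rewrite vat_upd; have -> : (j == a :> nat) = false by lia.
  by have -> : (j == (a.+1 - m)%N :> nat) = false by lia.
case: eqP => ji.
  have -> : (j == (a.+1 - m)%N :> nat) = false by lia.
  congr g; apply/ffunP => l; rewrite !ffunE vat_upd.
  by have -> : (i + l == a)%N = false by have := ltn_ord l; lia.
rewrite vat_upd /outer; have -> : (j < i)%N = false by lia.
by have -> : ((j + m).-1 == a)%N = (j == (a.+1 - m)%N :> nat) by lia.
Qed.

Definition qat r (q : {ffun 'I_r -> bool}) (a : nat) : bool :=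
  oapp q false (insub a).

Lemma vat_homog r (q : {ffun 'I_r -> bool}) (v : {ffun 'I_r -> tot}) a :
  (forall i, homog (q i) (v i)) -> homog (qat q a) (vat v a).
Proof.
by rewrite /vat /qat => h; case: insubP => //= _; apply: homog0.
Qed.

Lemma sum_qat r (q : {ffun 'I_r -> bool}) :
  \big[addb/false]_(i < r) q i = \big[addb/false]_(0 <= a < r) qat q a.
Proof.
rewrite big_mkord; apply: eq_bigr => i _.
by rewrite /qat valK.
Qed.

Lemma comp_fun_par n m r (i : 'I_n) p q f g : r.+1 = (n + m)%N ->
  has_parity p f -> has_parity q g ->
  has_parity (p (+) q) (@comp_fun n m r i q f g).
Proof.
move=> er fp gp e v hv.
pose B a b := \big[addb/false]_(a <= c < b) qat e c.
pose Q j := if (j < i)%N then qat e j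
  else if j == i then q (+) B i (i + m)%N else qat e (outer m i j).
have hQ : forall j : 'I_n, homog ([ffun j : 'I_n => Q j] j)
    (comp_arg i q g v j).
  move=> j; rewrite !ffunE /Q.
  case: ltnP => ji; first exact/homog_ksgn/vat_homog.
  rewrite -val_eqE; case: eqP => [_|_]; last exact: vat_homog.
  have -> : B i (i + m)%N =
      \big[addb/false]_(l < m) [ffun l : 'I_m => qat e (i + l)%N] l.
    rewrite /B -{1}(add0n (i : nat)) big_addn addKn big_mkord.
    by apply: eq_bigr => l _; rewrite ffunE addnC.
  by apply: gp => l; rewrite !ffunE; apply: vat_homog.
have := fp _ _ hQ; congr homog.
rewrite (sum_qat e) -addbA; congr (_ (+) _).
transitivity (\big[addb/false]_(0 <= j < n) Q j).
  by rewrite big_mkord; apply: eq_bigr => j _; rewrite ffunE.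
have ir : (i + m <= r)%N by have := ltn_ord i; lia.
rewrite (big_cat_nat (n := i)) //= 1?ltnW //.
rewrite (big_ltn (ltn_ord i)).
rewrite [X in _ = _ (+) X](big_cat_nat (n := i)) //=; last by lia.
rewrite [X in _ = _ (+) (_ (+) X)](big_cat_nat (n := (i + m)%N)) //=; last lia.
have -> : \big[addb/false]_(0 <= j < i) Q j = B 0%N i.
  by apply: eq_big_nat => j /andP[_ ji]; rewrite /Q ji.
rewrite {1}/Q ltnn eqxx.
have -> : \big[addb/false]_(i.+1 <= j < n) Q j = B (i + m)%N r.
  rewrite /B big_addn; have -> : (r - m = n.-1)%N by have := ltn_ord i; lia.
  rewrite big_add1; apply: eq_big_nat => j /andP[ij _].
  rewrite /Q /outer; have -> : (j.+1 < i)%N = false by lia.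
  have -> : (j.+1 == i)%N = false by lia.
  by rewrite addSn.
rewrite -/(B 0%N i) -/(B i (i + m)%N) -/(B (i + m)%N r).
by rewrite [RHS]addbCA -!addbA.
Qed.

Lemma act_fun_mult n (s : 'S_n) f : multilinear f -> multilinear (act_fun s f).
Proof.
move=> fl i v c x y; rewrite /act_fun scaler_sumr -big_split /=.
apply: eq_bigr => q _.
pose u (w : {ffun 'I_n -> tot}) := [ffun j => proj (q (s j)) (w (s j))].
have fu : multilinear (f \o u).
  apply: multilinear_comp fl _ => a w; exists (s^-1%g a), (proj (q a)).
    exact: proj_linear.
  move=> z; apply/ffunP => j; rewrite !ffunE.
  rewrite (can2_eq (permK s) (permKV s)).
  by case: eqP => // ->; rewrite permKV.
by have /= -> := fu i v c x y; rewrite scalerDr !scalerA mulrC.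
Qed.

Lemma act_fun_par n p (s : 'S_n) f :
  has_parity p f -> has_parity p (act_fun s f).
Proof.
move=> fp e v hv; apply: homog_sum => q; apply: homogZ.
rewrite (reindex_inj (@perm_inj _ s)) /=.
have -> : \big[addb/false]_(j < n) e (s j) =
    \big[addb/false]_(j < n) [ffun j => e (s j)] j.
  by apply: eq_bigr => j _; rewrite ffunE.
by apply: fp => j; rewrite !ffunE; apply: homog_proj.
Qed.

Lemma tot_d_linear : linear tot_d.
Proof. by move=> c x y; rewrite /tot_d /= !diff_lin. Qed.
HB.instance Definition _ :=
  GRing.isLinear.Build k tot tot *:%R tot_d tot_d_linear.

Lemma homog_tot_d q x : homog q x -> homog (~~ q) (tot_d x).
Proof.
have D0 p : D p 0 = 0.
  by have := @diff_lin _ _ D p (-1) 0 0; rewrite scaler0 addr0 scaleN1r addNr.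
by case: x => a b; case: q => -[<-]; rewrite /homog /proj /tot_d /= D0.
Qed.

Lemma d_fun_mult n p f : multilinear f -> multilinear (@d_fun n p f).
Proof.
move=> fl i v c x y; rewrite /d_fun fl linearP /=.
have -> : \sum_j f (d_arg j (upd v i (c *: x + y))) =
  c *: (\sum_j f (d_arg j (upd v i x))) + \sum_j f (d_arg j (upd v i y)).
  rewrite scaler_sumr -big_split /=; apply: eq_bigr => j _.
  suff fu : multilinear (f \o d_arg j) by apply: fu.
  apply: multilinear_comp fl _ => a w; exists a.
  exists (if (a < j)%N then ksgn true else if a == j then tot_d else idfun).
    by case: ifP => _; [exact: ksgn_linear|case: ifP => _;
      [exact: tot_d_linear|]].
  move=> z; apply/ffunP => b; rewrite !ffunE.
  by case: (b =P a) => [->|_]; case: ifP => // _; case: ifP.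
rewrite scalerDr opprD scalerBr !scalerA (mulrC c) -!addrA; congr (_ + _).
by rewrite addrCA.
Qed.

Lemma d_fun_par n p f : has_parity p f -> has_parity (~~ p) (@d_fun n p f).
Proof.
move=> fp e v hv; rewrite /d_fun -scaleNr addrC; apply: homogP; last first.
  by rewrite addNb; apply/homog_tot_d/fp.
apply: homog_sum => i.
pose e' := [ffun j : 'I_n => (j == i) (+) e j].
have -> : ~~ p (+) \big[addb/false]_j e j = p (+) \big[addb/false]_j e' j.
  have -> : \big[addb/false]_j e' j =
      \big[addb/false]_j (j == i) (+) \big[addb/false]_j e j.
    by rewrite -big_split; apply: eq_bigr => j _; rewrite ffunE.
  have -> : \big[addb/false]_(j < n) (j == i) = true.
    by rewrite (bigD1 i) //= eqxx big1 => [//|j /negbTE].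
  by rewrite addTb addNb addbN.
apply: fp => j; rewrite !ffunE.
case: ltnP => ji.
  by rewrite -val_eqE /= (ltn_eqF ji) addFb; apply: homog_ksgn.
by case: eqP => _; [rewrite addTb; apply: homog_tot_d|apply: hv].
Qed.

Lemma endo_comp_subproof n m r p q s (i : 'I_n) (er : r.+1 = (n + m)%N)
    (es : s = p (+) q) (f : endo n p) (g : endo m q) :
  is_end s (@comp_fun n m r i q f g).
Proof.
apply/asboolP; split; first by apply: comp_fun_mult => //; apply: endo_mult.
by rewrite es; apply: comp_fun_par => //; apply: endo_par.
Qed.

Definition endo_comp n m r p q s (i : 'I_n) (er : r.+1 = (n + m)%N)
    (es : s = p (+) q) (f : endo n p) (g : endo m q) : endo r s :=
  Endo (endo_comp_subproof i er es f g).

Lemma endo_act_subproof n p (s : 'S_n) (f : endo n p) : is_end p (act_fun s f).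
Proof.
apply/asboolP; split; first exact/act_fun_mult/endo_mult.
exact/act_fun_par/endo_par.
Qed.

Definition endo_act n p (s : 'S_n) (f : endo n p) : endo n p :=
  Endo (endo_act_subproof s f).

Lemma endo_d_subproof n p (f : endo n p) : is_end (~~ p) (d_fun p f).
Proof.
apply/asboolP; split; first exact/d_fun_mult/endo_mult.
exact/d_fun_par/endo_par.
Qed.

Definition endo_d n p (f : endo n p) : endo n (~~ p) :=
  Endo (endo_d_subproof f).

Definition endo_op : opStruct k :=
  @OpStruct k (fun n p => endo n p : lmodType k) endo_comp endo_act.

(* The endomorphism operad E(W, D). *)
Definition endo_dg : dgStruct k := @DgStruct k endo_op endo_d.
End Endomorphism.

(* The differential of \Pi V is -d, by the Koszul rule: \Pi is odd. *)
Section ParityReversion.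
Variables (k : fieldType) (V : bool -> lmodType k) (d : differential V).

Definition pi_sp (p : bool) : lmodType k := V (~~ p).

Definition pi_fun p (x : pi_sp p) : pi_sp (~~ p) := - d (~~ p) x.

Lemma pi_fun_lin p : linear (@pi_fun p).
Proof. by move=> c x y; rewrite /pi_fun diff_lin opprD scalerN. Qed.

Lemma pi_fun_sq p (x : pi_sp p) : pi_fun (pi_fun x) = 0.
Proof. by rewrite /pi_fun diffN diff_sq !oppr0. Qed.

Definition pi_d : differential pi_sp := Differential pi_fun_lin pi_fun_sq.
End ParityReversion.

(* [dgop_map] uses only the operations, so source and target are taken as
   [dgStruct]s, without their axioms. *)
Definition alg_structure (k : fieldType) (P : dgStruct k)
    (V : bool -> lmodType k) (d : differential V) : Type :=
  {f : forall n p, P n p -> endo_dg (pi_d d) n p | dgop_map f}.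

Definition maurer_cartan (k : fieldType) (P : dgStruct k) (m : P 1%N true) :
    Prop :=
  dg_d m + op_comp (ord0 : 'I_1) (erefl : 2 = (1 + 1)%N)
    (erefl : false = true (+) true) m m = 0.

Section Twist.
Variables (k : fieldType) (P : dgStruct k) (m : P 1%N true).

Lemma twist_arity n : n.+1 = (n + 1)%N.
Proof. by rewrite addn1. Qed.

Lemma twist_degree p : ~~ p = p (+) true.
Proof. by rewrite addbT. Qed.

Definition twist_delta n p (z : P n p) : P n (~~ p) :=
  op_comp (ord0 : 'I_1) (erefl : n.+1 = (1 + n)%N)
    (erefl : ~~ p = true (+) p) m z -
  (-1) ^+ p *: \sum_(i < n) op_comp i (twist_arity n) (twist_degree p) z m.

Definition twist (_ : maurer_cartan m) : dgStruct k :=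
  @DgStruct k P (fun n p z => dg_d z + twist_delta z).
End Twist.

(* O[m], as the quotient of the formal expressions in the elements of O and m
   by the congruence generated by the linear and operadic identities and the
   relations making O -> O[m] a map of graded operads. *)
Section FreeExtension.
Variables (k : fieldType) (O : dgOperad k).

Inductive term : nat -> bool -> Type :=
| Tgen n p : O n p -> term n p
| Tm : term 1 true
| Tcomp n m r p q s : 'I_n -> r.+1 = (n + m)%N -> s = p (+) q ->
    term n p -> term m q -> term r s
| Tact n p : 'S_n -> term n p -> term n p
| Tzero n p : term n p
| Tadd n p : term n p -> term n p -> term n p
| Tscale n p : k -> term n p -> term n p.

Arguments Tzero {n p}.

Inductive teq : forall n p, term n p -> term n p -> Prop :=
| teq_refl n p (x : term n p) : teq x x
| teq_sym n p (x y : term n p) : teq x y -> teq y x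
| teq_trans n p (x y z : term n p) : teq x y -> teq y z -> teq x z
| teq_Tcomp n m r p q s (i : 'I_n) (er : r.+1 = (n + m)%N)
    (es : s = p (+) q) (x x' : term n p) (y y' : term m q) :
    teq x x' -> teq y y' -> teq (Tcomp i er es x y) (Tcomp i er es x' y')
| teq_Tact n p (s : 'S_n) (x x' : term n p) :
    teq x x' -> teq (Tact s x) (Tact s x')
| teq_Tadd n p (x x' y y' : term n p) :
    teq x x' -> teq y y' -> teq (Tadd x y) (Tadd x' y')
| teq_Tscale n p (c : k) (x x' : term n p) :
    teq x x' -> teq (Tscale c x) (Tscale c x')
| teq_addA n p (x y z : term n p) :
    teq (Tadd x (Tadd y z)) (Tadd (Tadd x y) z)
| teq_addC n p (x y : term n p) : teq (Tadd x y) (Tadd y x)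
| teq_add0 n p (x : term n p) : teq (Tadd Tzero x) x
| teq_addN n p (x : term n p) : teq (Tadd (Tscale (-1) x) x) Tzero
| teq_scaleA n p (a b : k) (x : term n p) :
    teq (Tscale a (Tscale b x)) (Tscale (a * b) x)
| teq_scale1 n p (x : term n p) : teq (Tscale 1 x) x
| teq_scaleDr n p (a : k) (x y : term n p) :
    teq (Tscale a (Tadd x y)) (Tadd (Tscale a x) (Tscale a y))
| teq_scaleDl n p (a b : k) (x : term n p) :
    teq (Tscale (a + b) x) (Tadd (Tscale a x) (Tscale b x))
| teq_comp_linl n m r p q s (i : 'I_n) (er : r.+1 = (n + m)%N)
    (es : s = p (+) q) (c : k) (x x' : term n p) (y : term m q) :
    teq (Tcomp i er es (Tadd (Tscale c x) x') y)
        (Tadd (Tscale c (Tcomp i er es x y)) (Tcomp i er es x' y))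
| teq_comp_linr n m r p q s (i : 'I_n) (er : r.+1 = (n + m)%N)
    (es : s = p (+) q) (c : k) (x : term n p) (y y' : term m q) :
    teq (Tcomp i er es x (Tadd (Tscale c y) y'))
        (Tadd (Tscale c (Tcomp i er es x y)) (Tcomp i er es x y'))
| teq_act_lin n p (s : 'S_n) (c : k) (x y : term n p) :
    teq (Tact s (Tadd (Tscale c x) y)) (Tadd (Tscale c (Tact s x)) (Tact s y))
| teq_act_1 n p (x : term n p) : teq (Tact 1%g x) x
| teq_act_M n p (s t : 'S_n) (x : term n p) :
    teq (Tact (s * t)%g x) (Tact t (Tact s x))
| teq_comp_seq n m l r1 r2 r p q t s1 s2 s
    (i : 'I_n) (j : 'I_m) (h : 'I_r1)
    (er1 : r1.+1 = (n + m)%N) (es1 : s1 = p (+) q)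
    (er : r.+1 = (r1 + l)%N) (es : s = s1 (+) t)
    (er2 : r2.+1 = (m + l)%N) (es2 : s2 = q (+) t)
    (er' : r.+1 = (n + r2)%N) (es' : s = p (+) s2)
    (x : term n p) (y : term m q) (z : term l t) :
    h = (i + j)%N :> nat ->
    teq (Tcomp h er es (Tcomp i er1 es1 x y) z)
        (Tcomp i er' es' x (Tcomp j er2 es2 y z))
| teq_comp_par n m l r1 r2 r p q t s1 s2 s
    (i j : 'I_n) (h : 'I_r1) (h' : 'I_r2)
    (er1 : r1.+1 = (n + m)%N) (es1 : s1 = p (+) q)
    (er : r.+1 = (r1 + l)%N) (es : s = s1 (+) t)
    (er2 : r2.+1 = (n + l)%N) (es2 : s2 = p (+) t)
    (er' : r.+1 = (r2 + m)%N) (es' : s = s2 (+) q)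
    (x : term n p) (y : term m q) (z : term l t) :
    (i < j)%N -> h = outer m i j :> nat -> h' = i :> nat ->
    teq (Tcomp h er es (Tcomp i er1 es1 x y) z)
        (Tscale ((-1) ^+ (q && t))
           (Tcomp h' er' es' (Tcomp j er2 es2 x z) y))
| teq_comp_act n m r p q e (i : 'I_n) (er : r.+1 = (n + m)%N)
    (es : e = p (+) q) (s : 'S_n) (t : 'S_m) (u : 'S_r)
    (x : term n p) (y : term m q) :
    block_perm i s t u ->
    teq (Tcomp (s i) er es (Tact s x) (Tact t y)) (Tact u (Tcomp i er es x y))
| teq_gen_lin n p (c : k) (x y : O n p) :
    teq (Tgen (c *: x + y)) (Tadd (Tscale c (Tgen x)) (Tgen y))
| teq_gen_comp n m r p q s (i : 'I_n) (er : r.+1 = (n + m)%N)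
    (es : s = p (+) q) (x : O n p) (y : O m q) :
    teq (Tgen (op_comp i er es x y)) (Tcomp i er es (Tgen x) (Tgen y))
| teq_gen_act n p (s : 'S_n) (x : O n p) :
    teq (Tgen (op_act s x)) (Tact s (Tgen x)).

HB.instance Definition _ n p := gen_eqMixin (term n p).
HB.instance Definition _ n p := gen_choiceMixin (term n p).

Definition teqb n p (x y : term n p) : bool := `[< teq x y >].

Lemma teqb_equiv n p : equiv_class_of (@teqb n p).
Proof.
split=> [x|x y|y x z].
- exact/asboolP/teq_refl.
- by apply/asboolP/asboolP; apply: teq_sym.
- by move=> /asboolP xy /asboolP yz; apply/asboolP; apply: teq_trans xy yz.
Qed.

Canonical teq_equiv n p := EquivRelPack (teqb_equiv n p).

Definition free n p := {eq_quot (teq_equiv n p)}%qT.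

HB.instance Definition _ n p := Choice.on (free n p).
HB.instance Definition _ n p := EqQuotient.on (free n p).

Definition cl n p (x : term n p) : free n p := \pi_(free n p)%qT x.
Definition rp n p (x : free n p) : term n p := repr x.

Lemma clP n p (x y : term n p) : cl x = cl y <-> teq x y.
Proof.
split=> [/eqmodP/asboolP //|xy].
by apply/eqmodP/asboolP.
Qed.

Lemma rpK n p (x : free n p) : cl (rp x) = x.
Proof. exact: reprK. Qed.

Lemma rp_cl n p (x : term n p) : teq (rp (cl x)) x.
Proof. by apply/clP; rewrite rpK. Qed.

Definition free_zero n p : free n p := cl Tzero.
Definition free_add n p (x y : free n p) : free n p := cl (Tadd (rp x) (rp y)).
Definition free_scale n p (c : k) (x : free n p) : free n p :=
  cl (Tscale c (rp x)).
Definition free_opp n p (x : free n p) : free n p := free_scale (-1) x.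
Definition free_comp n m r p q s (i : 'I_n) (er : r.+1 = (n + m)%N)
    (es : s = p (+) q) (x : free n p) (y : free m q) : free r s :=
  cl (Tcomp i er es (rp x) (rp y)).
Definition free_act n p (s : 'S_n) (x : free n p) : free n p :=
  cl (Tact s (rp x)).

Lemma cl_add n p (x y : term n p) : cl (Tadd x y) = free_add (cl x) (cl y).
Proof. by apply/clP/teq_sym/teq_Tadd; apply: rp_cl. Qed.

Lemma cl_scale n p c (x : term n p) : cl (Tscale c x) = free_scale c (cl x).
Proof. by apply/clP/teq_sym/teq_Tscale; apply: rp_cl. Qed.

Lemma cl_comp n m r p q s (i : 'I_n) (er : r.+1 = (n + m)%N)
    (es : s = p (+) q) (x : term n p) (y : term m q) :
  cl (Tcomp i er es x y) = free_comp i er es (cl x) (cl y).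
Proof. by apply/clP/teq_sym/teq_Tcomp; apply: rp_cl. Qed.

Lemma cl_act n p (s : 'S_n) (x : term n p) :
  cl (Tact s x) = free_act s (cl x).
Proof. by apply/clP/teq_sym/teq_Tact; apply: rp_cl. Qed.

Lemma free_addA n p : associative (@free_add n p).
Proof.
move=> x y z; rewrite -(rpK x) -(rpK y) -(rpK z) -!cl_add.
exact/clP/teq_addA.
Qed.

Lemma free_addC n p : commutative (@free_add n p).
Proof.
by move=> x y; rewrite -(rpK x) -(rpK y) -!cl_add; apply/clP/teq_addC.
Qed.

Lemma free_add0 n p : left_id (@free_zero n p) (@free_add n p).
Proof. by move=> x; rewrite -(rpK x) -cl_add; apply/clP/teq_add0. Qed.

Lemma free_addN n p :
  left_inverse (@free_zero n p) (@free_opp n p) (@free_add n p).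
Proof.
move=> x; rewrite /free_opp -(rpK x) -cl_scale -cl_add.
exact/clP/teq_addN.
Qed.

HB.instance Definition _ n p := GRing.isZmodule.Build (free n p)
  (@free_addA n p) (@free_addC n p) (@free_add0 n p) (@free_addN n p).

Lemma free_scaleA n p a b (x : free n p) :
  free_scale a (free_scale b x) = free_scale (a * b) x.
Proof. by rewrite -(rpK x) -!cl_scale; apply/clP/teq_scaleA. Qed.

Lemma free_scale1 n p : left_id 1 (@free_scale n p).
Proof. by move=> x; rewrite -(rpK x) -!cl_scale; apply/clP/teq_scale1. Qed.

Lemma free_scaleDr n p : right_distributive (@free_scale n p) +%R.
Proof.
move=> a x y; change (free_scale a (free_add x y) =
  free_add (free_scale a x) (free_scale a y)).
rewrite -(rpK x) -(rpK y) -cl_add -!cl_scale -cl_add.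
exact/clP/teq_scaleDr.
Qed.

Lemma free_scaleDl n p (x : free n p) :
  {morph (@free_scale n p)^~ x : a b / a + b}.
Proof.
move=> a b; change (free_scale (a + b) x =
  free_add (free_scale a x) (free_scale b x)).
by rewrite -(rpK x) -!cl_scale -cl_add; apply/clP/teq_scaleDl.
Qed.

HB.instance Definition _ n p := GRing.Zmodule_isLmodule.Build k (free n p)
  (@free_scaleA n p) (@free_scale1 n p) (@free_scaleDr n p)
  (@free_scaleDl n p).

Definition free_op : opStruct k :=
  @OpStruct k (fun n p => free n p : lmodType k) free_comp free_act.

Definition fcl n p (x : term n p) : free_op n p := cl x.

Lemma fclP n p (x : free_op n p) : exists t, x = fcl t.
Proof. by exists (rp x); rewrite /fcl rpK. Qed.

Lemma fcl_teq n p (x y : term n p) : teq x y -> fcl x = fcl y.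
Proof. by move/clP. Qed.

Lemma fcl_add n p (x y : term n p) : fcl x + fcl y = fcl (Tadd x y).
Proof. exact/esym/cl_add. Qed.

Lemma fcl_scale n p c (x : term n p) : c *: fcl x = fcl (Tscale c x).
Proof. exact/esym/cl_scale. Qed.

Lemma fcl_comp n m r p q s (i : 'I_n) (er : r.+1 = (n + m)%N)
    (es : s = p (+) q) (x : term n p) (y : term m q) :
  op_comp i er es (fcl x) (fcl y) = fcl (Tcomp i er es x y).
Proof. exact/esym/cl_comp. Qed.

Lemma fcl_act n p (s : 'S_n) (x : term n p) :
  op_act s (fcl x) = fcl (Tact s x).
Proof. exact/esym/cl_act. Qed.

Lemma free_op_axioms : operad_axioms free_op.
Proof.
split.
- move=> n m r p q s i er es y c x x'.
  have [[[t ->] [u ->]] [v ->]] := (fclP x, fclP x', fclP y).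
  rewrite fcl_scale fcl_add !fcl_comp fcl_scale fcl_add.
  exact/fcl_teq/teq_comp_linl.
- move=> n m r p q s i er es x c y y'.
  have [[[t ->] [u ->]] [v ->]] := (fclP x, fclP y, fclP y').
  rewrite fcl_scale fcl_add !fcl_comp fcl_scale fcl_add.
  exact/fcl_teq/teq_comp_linr.
- move=> n p s c x y; have [[t ->] [u ->]] := (fclP x, fclP y).
  rewrite fcl_scale fcl_add !fcl_act fcl_scale fcl_add.
  exact/fcl_teq/teq_act_lin.
- by move=> n p x; have [t ->] := fclP x; rewrite fcl_act; apply/fcl_teq/teq_act_1.
- move=> n p s t x; have [u ->] := fclP x.
  by rewrite !fcl_act; apply/fcl_teq/teq_act_M.
- move=> n m l r1 r2 r p q t s1 s2 s i j h er1 es1 er es er2 es2 er' es' x y z.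
  have [[[a ->] [b ->]] [c ->]] := (fclP x, fclP y, fclP z).
  by move=> hij; rewrite !fcl_comp; apply/fcl_teq/teq_comp_seq.
- move=> n m l r1 r2 r p q t s1 s2 s i j h h' er1 es1 er es er2 es2 er' es'.
  move=> x y z ij hj hi; have [[[a ->] [b ->]] [c ->]] := (fclP x, fclP y, fclP z).
  by rewrite !fcl_comp fcl_scale; apply/fcl_teq/teq_comp_par.
- move=> n m r p q e i er es s t u x y hu.
  have [[a ->] [b ->]] := (fclP x, fclP y).
  by rewrite 2!fcl_act 2!fcl_comp fcl_act; apply/fcl_teq/teq_comp_act.
Qed.

Definition free_gen n p (x : O n p) : free_op n p := fcl (Tgen x).
Definition free_m : free_op 1 true := fcl (@Tm).

Lemma comp_degl p q s : s = p (+) q -> ~~ s = ~~ p (+) q.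
Proof. by move->; rewrite addNb. Qed.

Lemma comp_degr p q s : s = p (+) q -> ~~ s = p (+) ~~ q.
Proof. by move->; rewrite addbN. Qed.

Definition free_mm : free_op 1 false :=
  op_comp (ord0 : 'I_1) (erefl : 2 = (1 + 1)%N)
    (erefl : false = true (+) true) free_m free_m.

(* The derivation extending the differential of O with m |-> - m \circ_1 m. *)
Fixpoint term_d n p (x : term n p) : free_op n (~~ p) :=
  match x in term n p return free_op n (~~ p) with
  | Tgen _ _ x => free_gen (dg_d x)
  | Tm => - free_mm
  | Tcomp _ _ _ p _ _ i er es x y =>
      op_comp i er (comp_degl es) (term_d x) (fcl y) +
      (-1) ^+ p *:
        op_comp i er (comp_degr es) (fcl x) (term_d y)
  | Tact _ _ s x => op_act s (term_d x)
  | Tzero _ _ => 0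
  | Tadd _ _ x y => term_d x + term_d y
  | Tscale _ _ c x => c *: term_d x
  end.

Lemma term_d_comp n m r p q s (i : 'I_n) (er : r.+1 = (n + m)%N)
    (es : s = p (+) q) (x : term n p) (y : term m q) :
  term_d (Tcomp i er es x y) =
  op_comp i er (comp_degl es) (term_d x) (fcl y) +
  (-1) ^+ p *: op_comp i er (comp_degr es) (fcl x) (term_d y).
Proof. by []. Qed.

Lemma term_d_act n p (s : 'S_n) (x : term n p) :
  term_d (Tact s x) = op_act s (term_d x).
Proof. by []. Qed.

Lemma term_d_add n p (x y : term n p) :
  term_d (Tadd x y) = term_d x + term_d y.
Proof. by []. Qed.

Lemma term_d_scale n p c (x : term n p) :
  term_d (Tscale c x) = c *: term_d x.
Proof. by []. Qed.

Lemma term_d_gen n p (x : O n p) : term_d (Tgen x) = free_gen (dg_d x).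
Proof. by []. Qed.

Definition term_dE :=
  (term_d_comp, term_d_act, term_d_add, term_d_scale, term_d_gen).

Lemma op_compP_l n m r p q s (i : 'I_n) (er : r.+1 = (n + m)%N)
    (es : s = p (+) q) c (x x' : free_op n p) (y : free_op m q) :
  op_comp i er es (x + c *: x') y =
  op_comp i er es x y + c *: op_comp i er es x' y.
Proof. by rewrite addrC (comp_linl free_op_axioms) addrC. Qed.

Lemma op_compP_r n m r p q s (i : 'I_n) (er : r.+1 = (n + m)%N)
    (es : s = p (+) q) c (x : free_op n p) (y y' : free_op m q) :
  op_comp i er es x (y + c *: y') =
  op_comp i er es x y + c *: op_comp i er es x y'.
Proof. by rewrite addrC (comp_linr free_op_axioms) addrC. Qed.

Lemma term_d_teq n p (x y : term n p) : teq x y -> term_d x = term_d y.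
Proof.
have ax := free_op_axioms.
elim=> {n p x y}.
- by [].
- by [].
- by move=> n p x y z _ -> _ ->.
- move=> n m r p q s i er es x x' y y' /fcl_teq xx' hx /fcl_teq yy' hy.
  by rewrite !term_d_comp xx' yy' hx hy.
- by move=> n p s x x' _ hx; rewrite !term_d_act hx.
- by move=> n p x x' y y' _ hx _ hy; rewrite !term_d_add hx hy.
- by move=> n p c x x' _ hx; rewrite !term_d_scale hx.
- by move=> n p x y z; rewrite !term_d_add addrA.
- by move=> n p x y; rewrite !term_d_add addrC.
- by move=> n p x; rewrite term_d_add add0r.
- by move=> n p x; rewrite term_d_add term_d_scale scaleN1r addNr.
- by move=> n p a b x; rewrite !term_d_scale scalerA.
- by move=> n p x; rewrite term_d_scale scale1r.
- by move=> n p a x y; rewrite !(term_d_add, term_d_scale) scalerDr.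
- by move=> n p a b x; rewrite !(term_d_add, term_d_scale) scalerDl.
- move=> n m r p q s i er es c x x' y.
  rewrite !term_dE -fcl_add -fcl_scale !(comp_linl ax) !scalerDr !scalerA.
  by rewrite (mulrC _ c) addrACA.
- move=> n m r p q s i er es c x y y'.
  rewrite !term_dE -fcl_add -fcl_scale !(comp_linr ax) !scalerDr !scalerA.
  by rewrite (mulrC _ c) addrACA.
- by move=> n p s c x y; rewrite !term_dE (act_lin ax).
- by move=> n p x; rewrite term_d_act (act_1 ax).
- by move=> n p s t x; rewrite !term_d_act (act_M ax).
- move=> n m l r1 r2 r p q t s1 s2 s i j h er1 es1 er es er2 es2 er' es' x y z.
  move=> hij; rewrite !term_dE -!fcl_comp op_compP_l op_compP_r.
  rewrite scalerDr scalerA -addrA.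
  rewrite (comp_seq ax _ _ _ _ er2 es2 er' (comp_degl es') _ _ _ hij).
  rewrite (comp_seq ax _ _ _ _ er2 (comp_degl es2) er' (comp_degr es') _ _ _ hij).
  rewrite (comp_seq ax _ _ _ _ er2 (comp_degr es2) er' (comp_degr es') _ _ _ hij).
  by rewrite {1}es1 signr_addb.
- move=> n m l r1 r2 r p q t s1 s2 s i j h h' er1 es1 er es er2 es2 er' es'.
  move=> x y z ij hj hi; rewrite !term_dE -!fcl_comp !op_compP_l.
  rewrite !scalerDr -!addrA.
  rewrite (comp_par ax _ _ _ _ er2 (comp_degl es2) er' (comp_degl es') _ _ _ ij hj hi).
  rewrite (comp_par ax _ _ _ _ er2 es2 er' (comp_degr es') _ _ _ ij hj hi).
  rewrite (comp_par ax _ _ _ _ er2 (comp_degr es2) er' (comp_degl es') _ _ _ ij hj hi).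
  rewrite !scalerA; congr (_ + _); rewrite addrC; congr (_ *: _ + _ *: _).
    by rewrite {1}es1 -!signr_addb; congr (_ ^+ _); case: (p) (q) (t) => [] [] [].
  by rewrite {1}es2 -!signr_addb; congr (_ ^+ _); case: (p) (q) (t) => [] [] [].
- move=> n m r p q e i er es s t u x y hu.
  rewrite !term_dE -!fcl_act !(comp_act ax _ _ _ _ hu).
  by rewrite addrC -(act_lin ax) addrC.
- move=> n p c x y; rewrite !term_dE (d_lin (dgo_dg O)) /free_gen.
  by rewrite (fcl_teq (teq_gen_lin _ _ _)) -fcl_add -fcl_scale.
- move=> n m r p q s i er es x y; rewrite !term_dE.
  rewrite (d_comp (dgo_dg O) _ _ _ (comp_degl es) (comp_degr es)) /free_gen addrC.
  rewrite (fcl_teq (teq_gen_lin _ _ _)) -fcl_add -fcl_scale addrC.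
  by rewrite !(fcl_teq (teq_gen_comp _ _ _ _ _)) -!fcl_comp.
- move=> n p s x; rewrite !term_dE (d_act (dgo_dg O)) /free_gen.
  by rewrite (fcl_teq (teq_gen_act _ _)) -fcl_act.
Qed.

Definition free_d n p (x : free_op n p) : free_op n (~~ p) := term_d (rp x).

Lemma free_dE n p (x : term n p) : free_d (fcl x) = term_d x.
Proof. exact/term_d_teq/rp_cl. Qed.

Definition free_dg : dgStruct k := @DgStruct k free_op free_d.

Lemma free_m_mc : @maurer_cartan k free_dg free_m.
Proof. by rewrite /maurer_cartan {1}/free_m /= free_dE addNr. Qed.

Definition hat : dgStruct k := twist free_m_mc.

(* The map O -> O[m]; the underlying graded operad of [hat] is O[m]. *)
Definition hat_gen n p (x : O n p) : hat n p := free_gen x.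
Definition hat_m : hat 1%N true := free_m.
End FreeExtension.

(* Main.v *)
(* For an odd element E of arity 1 in any operad P, the operator
   z |-> E \circ_1 z - (-1)^|z| \sum_i z \circ_i E is a derivation of P, linear
   in E.  The differential of the endomorphism operad of (\Pi V, D) is this
   derivation for E = D.  If f is an algebra over O[m]^m on (V, d) and mu is the
   image of m, the twisted differential turns compatibility with d on O into
   compatibility with D - mu, and, m having twisted differential m \circ_1 m, it
   turns compatibility on m into [D, mu] = mu \circ_1 mu, that is
   (D - mu)^2 = 0.  Conversely (d', g) extends uniquely to O[m] by
   m |-> D - D'. *)
Require Import Defs.
From HB Require Import structures.
From mathcomp Require Import all_boot fingroup perm ssralg.
From mathcomp Require Import boolp functions zify.

Set Implicit Arguments.
Unset Strict Implicit.
Unset Printing Implicit Defensive.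

Import GRing.Theory.
Local Open Scope ring_scope.

(** * Preliminaries: linear maps, signs, and products over the inputs of a composite *)

Section LinearFacts.
Variables (k : fieldType) (U V : lmodType k) (f : U -> V).
Hypothesis f_lin : linear f.

Let h : {linear U -> V} :=
  HB.pack f (GRing.isLinear.Build k U V *:%R f f_lin).

Lemma lin0 : f 0 = 0. Proof. exact: (linear0 h). Qed.
Lemma linN x : f (- x) = - f x. Proof. exact: (linearN h). Qed.
Lemma linD x y : f (x + y) = f x + f y. Proof. exact: (linearD h). Qed.
Lemma linB x y : f (x - y) = f x - f y. Proof. exact: (linearB h). Qed.
Lemma linZ c x : f (c *: x) = c *: f x. Proof. exact: (linearZZ h). Qed.
Lemma lin_sum (I : Type) (r : seq I) (P : pred I) (F : I -> U) :
  f (\sum_(i <- r | P i) F i) = \sum_(i <- r | P i) f (F i).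
Proof. exact: (linear_sum h). Qed.
End LinearFacts.

(** Turns Koszul signs into parities, so that comparing signs becomes boolean algebra modulo 2. *)
Lemma prod_signr (k : fieldType) (I : finType) (P : pred I) (b : I -> bool) :
  \prod_(i | P i) (-1) ^+ b i = (-1) ^+ (\big[addb/false]_(i | P i) b i) :> k.
Proof. by rewrite (big_morph _ (@signr_addb k) (erefl _)). Qed.

(* The inputs of a partial composite x \circ_i y are the inputs j != i of x and
   the inputs of y. *)
Lemma big_block (R : Type) (idx : R) (op : Monoid.com_law idx) n m r (i : 'I_n)
    (G : 'I_r -> R) (Gn : 'I_n -> R) (Gm : 'I_m -> R) :
  r.+1 = (n + m)%N ->
  (forall (j : 'I_n) (a : 'I_r), j != i -> a = outer m i j :> nat ->
     G a = Gn j) ->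
  (forall (l : 'I_m) (a : 'I_r), a = (i + l)%N :> nat -> G a = Gm l) ->
  \big[op/idx]_a G a =
  op (\big[op/idx]_(j | j != i) Gn j) (\big[op/idx]_l Gm l).
Proof.
move=> er hn hm; have ltin := ltn_ord i.
(* With the default [idx] out of range, both sides become products over intervals of natural
   numbers, to be cut at [i] and [i + m]. [H] is neutral at [i], the input that the block
   replaces. *)
pose G' a := oapp G idx (insub a).
pose H (j : nat) := if j == i :> nat then idx else G' (outer m i j).
have -> : \big[op/idx]_a G a = \big[op/idx]_(0 <= a < r) G' a.
  by rewrite big_mkord; apply: eq_bigr => a _; rewrite /G' valK.
have -> : \big[op/idx]_(j | j != i) Gn j = \big[op/idx]_(0 <= j < n) H j.
  rewrite big_mkord big_mkcond; apply: eq_bigr => j _; rewrite /H val_eqE.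
  case: eqP => //= /eqP ji; have jr : (outer m i j < r)%N.
    rewrite /outer; case: ifP => ? //; first by lia.
    by have := ltn_ord j; move: ji; rewrite -val_eqE /=; lia.
  by rewrite /G' insubT /= (hn j).
have -> : \big[op/idx]_l Gm l = \big[op/idx]_(i <= a < i + m) G' a.
  rewrite -{1}[i : nat]add0n big_addn addKn big_mkord.
  apply: eq_bigr => l _; rewrite /G' addnC; have lr : (i + l < r)%N.
    by have := ltn_ord l; lia.
  by rewrite insubT /= (hm l).
rewrite (big_cat_nat (n := i)) //=; last by lia.
rewrite (big_cat_nat (m := i) (n := (i + m)%N)) ?leq_addr //=; last by lia.
rewrite [in RHS](big_cat_nat (n := i)) //= 1?ltnW //.
rewrite [in RHS](big_ltn ltin) {2}/H eqxx Monoid.mul1m.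
have -> : \big[op/idx]_(0 <= j < i) H j = \big[op/idx]_(0 <= j < i) G' j.
  apply: eq_big_nat => j /andP[_ ji].
  by rewrite /H /outer ji; case: eqP => // ji'; move: ji; rewrite ji' ltnn.
have -> : \big[op/idx]_(i.+1 <= j < n) H j =
    \big[op/idx]_(i + m <= a < r) G' a.
  rewrite [RHS]big_addn; have -> : (r - m = n.-1)%N by lia.
  rewrite big_add1; apply: eq_big_nat => j /andP[ij _].
  rewrite /H /outer; have -> : (j.+1 == i :> nat) = false by lia.
  by have -> : (j.+1 < i)%N = false by lia.
by rewrite -Monoid.mulmA; congr (op _ _); rewrite Monoid.mulmC.
Qed.

(** * Multilinear maps on homogeneous arguments *)

Section Multilinear.
Variables (k : fieldType) (W : bool -> lmodType k).
Implicit Types (n : nat).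

Lemma upd_id n (v : {ffun 'I_n -> tot W}) i : upd v i (v i) = v.
Proof. by apply/ffunP => j; rewrite ffunE; case: eqP => // ->. Qed.

Lemma multilinear0 n (f : {ffun 'I_n -> tot W} -> tot W)
    (v : {ffun 'I_n -> tot W}) i :
  multilinear f -> v i = 0 -> f v = 0.
Proof. by move=> fl vi; rewrite -(upd_id v i) vi (lin0 (fl i v)). Qed.

(** The scalars come out one index at a time; [gen] runs over a duplicate-free list of the indices
    being scaled. *)
Lemma multilinear_scale n (f : {ffun 'I_n -> tot W} -> tot W) (c : 'I_n -> k)
    (v : {ffun 'I_n -> tot W}) :
  multilinear f -> f [ffun j => c j *: v j] = (\prod_j c j) *: f v.
Proof.
move=> fl.
have gen (s : seq 'I_n) : uniq s ->
    f [ffun j => if j \in s then c j *: v j else v j] =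
    (\prod_(j <- s) c j) *: f v.
  elim: s => [_|a s ih /= /andP[as_ us]].
    by rewrite big_nil scale1r; congr f; apply/ffunP => j; rewrite ffunE.
  rewrite big_cons -scalerA -ih //; set w := (X in _ = c a *: f X).
  rewrite -[w in RHS](upd_id w a) -(linZ (fl a w)); congr f.
  apply/ffunP => j; rewrite !ffunE inE; case: eqP => //= ->.
  by rewrite (negbTE as_).
rewrite -(gen _ (index_enum_uniq _)); congr f.
by apply/ffunP => j; rewrite !ffunE mem_index_enum.
Qed.

Lemma proj_split (x : tot W) : x = proj false x + proj true x.
Proof. by case: x => a b; congr pair; rewrite /= ?addr0 ?add0r. Qed.

Lemma homog_projq q (x : tot W) : homog q (proj q x).
Proof. by case: q. Qed.

Lemma proj_homog p q (x : tot W) :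
  homog p x -> proj q x = if p == q then x else 0.
Proof. by case: x => a b; case: p; case: q => //; case=> <-. Qed.

Lemma ksgn_homog p q (x : tot W) :
  homog p x -> ksgn q x = (-1) ^+ (q && p) *: x.
Proof.
case: x => a b; case: p => -[<-]; rewrite /ksgn /= ?andbT ?andbF.
  by congr pair; rewrite /= scaler0.
by congr pair; rewrite /= ?scale1r ?scaler0.
Qed.

(** Each argument is the sum of its even and odd parts, and multilinearity splits one argument at a
    time. *)
Lemma homog_ext n (f g : {ffun 'I_n -> tot W} -> tot W) :
  multilinear f -> multilinear g ->
  (forall (e : {ffun 'I_n -> bool}) (v : {ffun 'I_n -> tot W}),
     (forall i, homog (e i) (v i)) -> f v = g v) ->
  f =1 g.
Proof.
move=> fl gl fg v.
(* Only the arguments from position [h] on are assumed homogeneous: [h = 0] is the hypothesis, and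
   [h = n] leaves no condition. *)
have gen h : (h <= n)%N ->
    forall (e : {ffun 'I_n -> bool}) (v : {ffun 'I_n -> tot W}),
    (forall i : 'I_n, (h <= i)%N -> homog (e i) (v i)) -> f v = g v.
  elim: h => [_ e w hw|h ih hn e w hw]; first by apply: (fg e) => i; apply: hw.
  pose a := Ordinal hn.
  have step q : f (upd w a (proj q (w a))) = g (upd w a (proj q (w a))).
    apply: (ih (ltnW hn) [ffun j => if j == a then q else e j]) => j hj.
    rewrite !ffunE; case: eqP => [_|/eqP ja]; first exact: homog_projq.
    by apply: hw; move: ja; rewrite -val_eqE /=; lia.
  rewrite -(upd_id w a) (proj_split (w a)).
  by rewrite (linD (fl a w)) (linD (gl a w)) !step.
by apply: (gen n (leqnn n) [ffun=> false]) => i; rewrite leqNgt ltn_ord.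
Qed.

Lemma endo_ext n p (f g : endo W n p) :
  (forall (e : {ffun 'I_n -> bool}) (v : {ffun 'I_n -> tot W}),
     (forall i, homog (e i) (v i)) -> f v = g v) ->
  f = g.
Proof.
by move=> fg; apply/val_inj/funext; apply: homog_ext => //; apply: endo_mult.
Qed.

(** On homogeneous arguments both sides are signed copies of [f v], and the degree of [f v] exceeds
    the total degree of the arguments by [p]. *)
Lemma endo_ksgn n p t (f : endo W n p) (v : {ffun 'I_n -> tot W}) :
  f [ffun l => ksgn t (v l)] = (-1) ^+ (p && t) *: ksgn t (f v).
Proof.
have fl := endo_mult f; move: v.
apply: homog_ext => [||e v hv].
- apply: (multilinear_comp fl) => i v; exists i, (ksgn t).
    exact: ksgn_linear.
  by move=> x; apply/ffunP => j; rewrite !ffunE; case: ifP.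
- move=> i v c x y; rewrite fl linearP scalerDr !scalerA mulrC.
  by rewrite mulrC.
rewrite (ksgn_homog t (endo_par f hv)) scalerA -signr_addb.
have -> : [ffun l => ksgn t (v l)] = [ffun l => (-1) ^+ (t && e l) *: v l].
  by apply/ffunP => l; rewrite !ffunE (ksgn_homog _ (hv l)).
rewrite multilinear_scale // prod_signr; congr (_ ^+ _ *: _).
by rewrite -big_distrr /=; case: (p) (t) (bigop.body _ _ _) => [] [] [].
Qed.

End Multilinear.

(** * The endomorphism operad satisfies the operad axioms *)

Section EndoOperad.
Variables (k : fieldType) (W : bool -> lmodType k).
Local Notation T := (tot W).

Lemma ltn_outer n m r (i j : 'I_n) : r.+1 = (n + m)%N -> j != i ->
  (outer m i j < r)%N.
Proof.
move=> er ji; have := (ltn_ord i, ltn_ord j) => -[li lj].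
by move: ji; rewrite /outer -val_eqE /=; case: ifP; lia.
Qed.

Lemma vat_ord r (v : {ffun 'I_r -> T}) (a : 'I_r) : vat v a = v a.
Proof. by rewrite /vat valK. Qed.

Lemma ksgnC q t (x : T) : ksgn q (ksgn t x) = ksgn (q (+) t) x.
Proof. by congr pair; rewrite /= scalerA -signr_addb. Qed.

Lemma vat_comp_arg n m r (i : 'I_n) q (g : {ffun 'I_m -> T} -> T)
    (v : {ffun 'I_r -> T}) a :
  (a < n)%N -> vat (comp_arg i q g v) a =
    if (a < i)%N then ksgn q (vat v a)
    else if a == i then g [ffun l : 'I_m => vat v (i + l)]
    else vat v (outer m i a).
Proof. by move=> an; rewrite -[a]/(val (Ordinal an)) vat_ord ffunE. Qed.

Lemma vat_shift r r' (v : {ffun 'I_r' -> T}) c b :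
  (b < r)%N -> vat [ffun a : 'I_r => vat v (c + a)] b = vat v (c + b).
Proof. by move=> br; rewrite -[b]/(val (Ordinal br)) vat_ord ffunE. Qed.

(** Both sides apply [x] to the same arguments: left of the block the signs of [y] and [z] combine
    to that of their composite, and inside the block the same comparison recurs for [y]. *)
Lemma endo_comp_seq n m l r1 r2 r p q t s1 s2 s
    (i : 'I_n) (j : 'I_m) (h : 'I_r1)
    (er1 : r1.+1 = (n + m)%N) (es1 : s1 = p (+) q)
    (er : r.+1 = (r1 + l)%N) (es : s = s1 (+) t)
    (er2 : r2.+1 = (m + l)%N) (es2 : s2 = q (+) t)
    (er' : r.+1 = (n + r2)%N) (es' : s = p (+) s2)
    (x : endo W n p) (y : endo W m q) (z : endo W l t) :
  h = (i + j)%N :> nat ->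
  endo_comp h er es (endo_comp i er1 es1 x y) z =
  endo_comp i er' es' x (endo_comp j er2 es2 y z).
Proof.
move=> hij; apply/val_inj/funext => v /=; rewrite /comp_fun; congr (x _).
have := (ltn_ord i, ltn_ord j) => -[li lj].
apply/ffunP => a; rewrite !ffunE; have := ltn_ord a => an.
case: ltnP => ai.
  rewrite vat_comp_arg; last by lia.
  have -> : (a < h)%N by lia.
  by rewrite ksgnC es2.
rewrite -val_eqE /=; case: eqP => ai'.
  congr (y _); apply/ffunP => b; rewrite !ffunE; have lb := ltn_ord b.
  rewrite vat_comp_arg; last by lia.
  have -> : (i + b < h)%N = (b < j)%N by lia.
  rewrite -val_eqE /=; have -> : (i + b == h)%N = (b == j :> nat) by lia.
  case: ltnP => bj; first by rewrite vat_shift //; lia.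
  case: eqP => bj'.
    congr (z _); apply/ffunP => c; rewrite !ffunE vat_shift ?hij ?addnA //.
    by have := ltn_ord c; lia.
  rewrite vat_shift; last by rewrite /outer; case: ifP; lia.
  by rewrite /outer !ifF; try lia; congr vat; lia.
rewrite vat_comp_arg; last by rewrite /outer; case: ifP; lia.
by rewrite /outer !ifF; try lia; congr vat; lia.
Qed.

(** The sign appears when the operator [ksgn t], which [z] puts on the inputs to its left, is pulled
    out of [y] by [endo_ksgn]. *)
Lemma endo_comp_par n m l r1 r2 r p q t s1 s2 s
    (i j : 'I_n) (h : 'I_r1) (h' : 'I_r2)
    (er1 : r1.+1 = (n + m)%N) (es1 : s1 = p (+) q)
    (er : r.+1 = (r1 + l)%N) (es : s = s1 (+) t)
    (er2 : r2.+1 = (n + l)%N) (es2 : s2 = p (+) t)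
    (er' : r.+1 = (r2 + m)%N) (es' : s = s2 (+) q)
    (x : endo W n p) (y : endo W m q) (z : endo W l t) :
  (i < j)%N -> h = outer m i j :> nat -> h' = i :> nat ->
  endo_comp h er es (endo_comp i er1 es1 x y) z =
  (-1) ^+ (q && t) *: endo_comp h' er' es' (endo_comp j er2 es2 x z) y.
Proof.
move=> ij hj hi; apply/val_inj/funext => v.
change (x (comp_arg i q y (comp_arg h t z v)) =
  (-1) ^+ (q && t) *: x (comp_arg j t z (comp_arg h' q y v))).
have := (ltn_ord i, ltn_ord j) => -[li lj].
have {}hj : h = (j + m).-1 :> nat by rewrite hj /outer ifF //; lia.
set w := comp_arg j t z _.
(* Multilinearity moves the sign into argument [i], where the output of [y] sits; the other
   arguments agree without a sign. *)
rewrite -[w in RHS](upd_id w i) -(linZ (endo_mult x i w)); congr (x _).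
apply/ffunP => a; rewrite /w !ffunE -!val_eqE /= ij; have := ltn_ord a => an.
case: ltnP => ai.
  have -> : (a == i :> nat) = false by lia.
  have -> : (a < j)%N by lia.
  rewrite !vat_comp_arg; try lia.
  have -> : (a < h)%N by lia.
  have -> : (a < h')%N by lia.
  by rewrite !ksgnC addbC.
case: eqP => ai'.
  rewrite vat_comp_arg; last by lia.
  rewrite hi ltnn eqxx -(endo_ksgn).
  congr (y _); apply/ffunP => b; rewrite !ffunE; have lb := ltn_ord b.
  rewrite vat_comp_arg; last by lia.
  by have -> : (i + b < h)%N by lia.
have oi : outer m i a = (a + m).-1 by rewrite /outer ifF //; lia.
rewrite vat_comp_arg; last by lia.
have -> : (outer m i a < h)%N = (a < j)%N by lia.
have -> : (outer m i a == h)%N = (a == j :> nat) by lia.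
case: ltnP => aj.
  rewrite vat_comp_arg; last by lia.
  rewrite !ifF; try lia.
  by rewrite hi.
case: eqP => aj'.
  congr (z _); apply/ffunP => b; rewrite !ffunE; have lb := ltn_ord b.
  rewrite vat_comp_arg; last by lia.
  rewrite !ifF; try lia.
  by rewrite /outer !ifF; try lia; congr vat; lia.
rewrite vat_comp_arg; last by rewrite /outer; case: ifP; lia.
by rewrite /outer !ifF; try lia; congr vat; lia.
Qed.

(** The parity of the number of inversions of [s] between odd arguments. All conditions stand in the
    summand, so that the sums can be reindexed and exchanged freely. *)
Definition koszul_exp n (s : 'S_n) (q : {ffun 'I_n -> bool}) : bool :=
  \big[addb/false]_(a < n) \big[addb/false]_(b < n)
    [&& (a < b)%N, (s b < s a)%N, q (s a) & q (s b)].

Lemma koszulE n (s : 'S_n) (q : {ffun 'I_n -> bool}) :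
  koszul k s q = (-1) ^+ koszul_exp s q.
Proof.
rewrite /koszul_exp -prod_signr; apply: eq_bigr => a _.
rewrite -prod_signr big_mkcond; apply: eq_bigr => b _.
by rewrite andbA; case: ifP.
Qed.

Lemma act_fun_homog n (s : 'S_n) (f : {ffun 'I_n -> T} -> T)
    (e : {ffun 'I_n -> bool}) (v : {ffun 'I_n -> T}) :
  multilinear f -> (forall i, homog (e i) (v i)) ->
  act_fun s f v = koszul k s e *: f [ffun j => v (s j)].
Proof.
move=> fl hv; rewrite /act_fun (bigD1 e) //= [X in _ + X]big1 ?addr0.
  by congr (_ *: f _); apply/ffunP => j; rewrite !ffunE hv.
(* A degree vector [q] other than [e] projects some argument [v a] to zero, and [f] receives it at
   position [s^-1 a]. *)
move=> q qe; have [a qa] : exists a, q a != e a.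
  by apply/existsP; apply: contraNT qe => /existsPn h; apply/eqP/ffunP => a;
    apply/eqP; move: (h a); rewrite negbK.
rewrite (multilinear0 (i := s^-1%g a) fl) ?scaler0 // ffunE permKV.
by rewrite (proj_homog _ (hv a)) eq_sym (negbTE qa).
Qed.

Lemma endo_act_lin n p (s : 'S_n) : linear (@endo_act k W n p s).
Proof.
move=> c x y; apply/val_inj/funext => v.
change (act_fun s (c *: x + y) v = c *: act_fun s x v + act_fun s y v).
rewrite /act_fun scaler_sumr -big_split; apply: eq_bigr => q _.
by rewrite /= scalerDr !scalerA mulrC.
Qed.

Lemma endo_comp_linl n m r p q s (i : 'I_n) (er : r.+1 = (n + m)%N)
    (es : s = p (+) q) (y : endo W m q) :
  linear (fun x : endo W n p => endo_comp i er es x y).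
Proof. by move=> c x x'; apply/val_inj/funext. Qed.

Lemma endo_comp_linr n m r p q s (i : 'I_n) (er : r.+1 = (n + m)%N)
    (es : s = p (+) q) (x : endo W n p) :
  linear (fun y : endo W m q => endo_comp i er es x y).
Proof.
move=> c y y'; apply/val_inj/funext => v.
change (x (comp_arg i q (c *: y + y') v) =
  c *: x (comp_arg i q y v) + x (comp_arg i q y' v)).
(* Only argument [i] of [x] depends on [g], so linearity of [x] in that argument suffices. *)
have upd_arg (g : endo W m q) : comp_arg i q g v =
    upd (comp_arg i q y v) i (g [ffun l : 'I_m => vat v (i + l)]).
  apply/ffunP => j; rewrite !ffunE.
  by case: eqP => // ->; rewrite ltnn.
have := endo_mult x i (comp_arg i q y v) c
  (y [ffun l : 'I_m => vat v (i + l)]) (y' [ffun l : 'I_m => vat v (i + l)]).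
by rewrite /= -!upd_arg => <-; rewrite (upd_arg (c *: y + y')).
Qed.

Lemma endo_act_1 n p (x : endo W n p) : endo_act 1%g x = x.
Proof.
apply: endo_ext => e v hv.
rewrite [LHS](act_fun_homog _ (endo_mult x) hv) koszulE /koszul_exp.
rewrite big1 ?expr0 ?scale1r.
  by congr (x _); apply/ffunP => j; rewrite ffunE perm1.
move=> a _; rewrite big1 // => b _; rewrite !perm1.
by case: ltngtP.
Qed.

(** Off the diagonal each unordered pair is counted twice, hence cancels modulo 2. *)
Lemma sym_addb (n : nat) (K : 'I_n -> 'I_n -> bool) :
  (forall a b, K a b = K b a) -> (forall a, K a a = false) ->
  \big[addb/false]_(a < n) \big[addb/false]_(b < n) K a b = false.
Proof.
move=> Ksym K0.
transitivity (\big[addb/false]_(a < n) \big[addb/false]_(b < n)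
    ((a < b)%N && K a b) (+)
  \big[addb/false]_(a < n) \big[addb/false]_(b < n) ((b < a)%N && K a b)).
  rewrite -big_split; apply: eq_bigr => a _; rewrite -big_split.
  apply: eq_bigr => b _ /=; case: ltngtP => [_|_|/val_inj ->] /=.
  - by rewrite addbF.
  - by [].
  - by rewrite K0.
rewrite [X in _ (+) X]exchange_big /=.
rewrite [X in _ (+) X](eq_bigr (fun a : 'I_n => \big[addb/false]_(b < n)
    ((a < b)%N && K a b))) ?addbb // => a _.
by apply: eq_bigr => b _; rewrite Ksym.
Qed.

(** A permutation only rearranges unordered pairs. After reindexing, the difference of the two sums
    has a symmetric summand that vanishes on the diagonal, so [sym_addb] applies. *)
Lemma pair_addb (n : nat) (s : 'S_n) (G : 'I_n -> 'I_n -> bool) :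
  (forall a b, G a b = G b a) ->
  \big[addb/false]_(a < n) \big[addb/false]_(b < n)
    ((a < b)%N && G (s a) (s b)) =
  \big[addb/false]_(a < n) \big[addb/false]_(b < n) ((a < b)%N && G a b).
Proof.
move=> Gsym; apply/eqP; rewrite -negb_add; apply/negPf.
rewrite [X in _ (+) X](reindex_inj (@perm_inj _ s)) -big_split /=.
under eq_bigr => a _ do
  rewrite [X in _ (+) X](reindex_inj (@perm_inj _ s)) -big_split /=.
apply: sym_addb => [a b|a]; last by rewrite !ltnn.
rewrite (Gsym (s b)); case: (eqVneq a b) => [->//|ab].
have sab : s a != s b by rewrite (inj_eq perm_inj).
move: ab sab; rewrite -!val_eqE /= !neq_ltn.
by case: (G _ _); case: (ltngtP a b); case: (ltngtP (s a) (s b)).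
Qed.

(** [s * t] inverts a pair when exactly one of these happens: [s] inverts it, or [t] inverts its
    image under [s]. *)
Lemma koszul_expM n (s t : 'S_n) (q : {ffun 'I_n -> bool}) :
  koszul_exp (s * t)%g q =
  koszul_exp t q (+) koszul_exp s [ffun a => q (t a)].
Proof.
(* [G a b] says that [t] inverts the unordered pair of [a] and [b], with odd degrees at both images.
   Being symmetric, it can be summed along [s] by [pair_addb]. *)
pose G (a b : 'I_n) := ((a < b)%N (+) (t a < t b)%N) && q (t a) && q (t b).
have -> : koszul_exp t q = \big[addb/false]_(a < n) \big[addb/false]_(b < n)
    ((a < b)%N && G (s a) (s b)).
  rewrite (pair_addb _ (G := G)); last first.
    move=> a b; rewrite /G; case: (eqVneq a b) => [->//|ab].
    have tab : t a != t b by rewrite (inj_eq perm_inj).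
    move: ab tab; rewrite -!val_eqE /= !neq_ltn -!andbA (andbC (q (t a))).
    by case: (ltngtP a b); case: (ltngtP (t a) (t b)).
  apply: eq_bigr => a _; apply: eq_bigr => b _; rewrite /G.
  case: ltnP => //= ab; case: ltnP => tba; first by rewrite ltnNge ltnW.
  have : t b != t a by rewrite (inj_eq perm_inj) -val_eqE /= gtn_eqF.
  by rewrite -val_eqE /=; case: (ltngtP (t b) (t a)) tba.
rewrite -big_split; apply: eq_bigr => a _; rewrite -big_split.
apply: eq_bigr => b _; rewrite /G !ffunE !permM.
case: ltnP => //= ab; have {ab} : a != b by rewrite -val_eqE /= ltn_eqF.
move=> ab; have sab : s a != s b by rewrite (inj_eq perm_inj).
have tab : t (s a) != t (s b) by rewrite (inj_eq perm_inj).
move: sab tab; rewrite -!val_eqE /= !neq_ltn.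
by case: (ltngtP (s a) (s b)); case: (ltngtP (t (s a)) (t (s b))) => // _ _ _ _;
  case: (q _) (q _) => [] [].
Qed.

Lemma endo_act_M n p (s t : 'S_n) (x : endo W n p) :
  endo_act (s * t)%g x = endo_act t (endo_act s x).
Proof.
apply: endo_ext => e v hv.
rewrite [LHS](act_fun_homog _ (endo_mult x) hv).
rewrite [RHS](act_fun_homog _ (act_fun_mult s (endo_mult x)) hv).
rewrite (act_fun_homog (e := [ffun a => e (t a)]) s (endo_mult x)); last first.
  by move=> i; rewrite !ffunE.
rewrite scalerA !koszulE koszul_expM signr_addb; congr (_ *: x _).
by apply/ffunP => j; rewrite !ffunE permM.
Qed.

(* Inversions of the block permutation [u] within the block are those of [t],
   outside it those of [s], and an input [j != i] is inverted with all or none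
   of the block. *)
Lemma koszul_exp_block n m r (i : 'I_n) (s : 'S_n) (t : 'S_m) (u : 'S_r) q
    (e : {ffun 'I_r -> bool}) (d : {ffun 'I_n -> bool})
    (b : {ffun 'I_m -> bool}) :
  r.+1 = (n + m)%N -> block_perm i s t u ->
  (forall (j : 'I_n) (a : 'I_r), j != i -> a = outer m i j :> nat ->
     d (s j) = e (u a)) ->
  (forall (l : 'I_m) (a : 'I_r), a = (i + l)%N :> nat -> b (t l) = e (u a)) ->
  d (s i) = q (+) \big[addb/false]_l b l ->
  koszul_exp s d (+) koszul_exp t b (+)
    \big[addb/false]_(j | j != i) (q && d (s j) && ((j < i) (+) (s j < s i)))%N
  = koszul_exp u e.
Proof.
move=> er [hm hn] de be di.
(* A block input compares with an outer input just as [i] does, before and after the permutation. *)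
have inner_lt (l : 'I_m) (j : 'I_n) : j != i ->
    ((i + l < outer m i j) = (i < j))%N /\ ((outer m i j < i + l) = (j < i))%N.
  by rewrite -val_eqE /= /outer; have := ltn_ord l; case: ifP; lia.
have inner_lt' (l : 'I_m) (j : 'I_n) : j != i ->
    ((s i + t l < outer m (s i) (s j)) = (s i < s j))%N /\
    ((outer m (s i) (s j) < s i + t l) = (s j < s i))%N.
  move=> ji; have : s j != s i by rewrite (inj_eq perm_inj).
  by rewrite -val_eqE /= /outer; have := ltn_ord (t l); case: ifP; lia.
have outer_mono (h j j' : 'I_n) : j != h -> j' != h ->
    (outer m h j < outer m h j')%N = (j < j')%N.
  by rewrite -!val_eqE /= /outer; case: ifP; case: ifP; lia.
have sinj j : j != i -> s j != s i by rewrite (inj_eq perm_inj).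
pose X := \big[addb/false]_(j | j != i) \big[addb/false]_(j' | j' != i)
  [&& (j < j')%N, (s j' < s j)%N, d (s j) & d (s j')].
pose B := \big[addb/false]_l b l.
have BE : B = \big[addb/false]_l b (t l).
  by rewrite /B (reindex_inj (@perm_inj _ t)).
(* [big_block] in both indices separates the pairs according to which of their members lie in the
   block. *)
have -> : koszul_exp u e =
  \big[addb/false]_(j | j != i) (\big[addb/false]_(j' | j' != i)
     [&& (j < j')%N, (s j' < s j)%N, d (s j) & d (s j')] (+)
     [&& (j < i)%N, (s i < s j)%N, d (s j) & B]) (+)
  \big[addb/false]_(l < m) (\big[addb/false]_(j | j != i)
     [&& (i < j)%N, (s j < s i)%N, b (t l) & d (s j)] (+)
     \big[addb/false]_(l' < m)
       [&& (l < l')%N, (t l' < t l)%N, b (t l) & b (t l')]).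
  apply: (big_block _ er) => [j a ji aj|l a al].
    rewrite (big_block (i := i) (m := m) (Gn := fun j' =>
      [&& (j < j')%N, (s j' < s j)%N, d (s j) & d (s j')]) (Gm := fun l =>
      [&& (j < i)%N, (s i < s j)%N, d (s j) & b (t l)]) _ er) /=.
    - by rewrite BE -!big_distrr.
    - move=> j' a' j'i a'j'; rewrite (de _ _ ji aj) (de _ _ j'i a'j').
      by rewrite (hn _ _ ji aj) (hn _ _ j'i a'j') aj a'j' !outer_mono ?sinj.
    move=> l a' a'l; rewrite (de _ _ ji aj) (be _ _ a'l).
    rewrite (hn _ _ ji aj) (hm _ _ a'l) aj a'l.
    by have [_ ->] := inner_lt l j ji; have [-> _] := inner_lt' l j ji.
  rewrite (big_block (i := i) (m := m) (Gn := fun j =>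
    [&& (i < j)%N, (s j < s i)%N, b (t l) & d (s j)]) (Gm := fun l' =>
    [&& (l < l')%N, (t l' < t l)%N, b (t l) & b (t l')]) _ er) //=.
    move=> j a' ji a'j; rewrite (de _ _ ji a'j) (be _ _ al).
    rewrite (hn _ _ ji a'j) (hm _ _ al) al a'j.
    by have [-> _] := inner_lt l j ji; have [_ ->] := inner_lt' l j ji.
  move=> l' a' a'l'; rewrite (be _ _ al) (be _ _ a'l').
  by rewrite (hm _ _ al) (hm _ _ a'l') al a'l' !ltn_add2l.
have -> : koszul_exp s d = \big[addb/false]_(j | j != i)
    (\big[addb/false]_(j' | j' != i)
     [&& (j < j')%N, (s j' < s j)%N, d (s j) & d (s j')] (+)
     [&& (j < i)%N, (s i < s j)%N, d (s j) & q (+) B]) (+)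
  \big[addb/false]_(j | j != i)
     [&& (i < j)%N, (s j < s i)%N, q (+) B & d (s j)].
  rewrite /koszul_exp (bigD1 i) //= addbC; congr (_ (+) _).
    by apply: eq_bigr => j ji; rewrite (bigD1 i) //= addbC di.
  by rewrite (bigD1 i) //= ltnn -di.
rewrite !big_split /= [X in _ = _ (+) (X (+) _)]exchange_big /=.
have -> : \big[addb/false]_(j | j != i) \big[addb/false]_l
    [&& (i < j)%N, (s j < s i)%N, b (t l) & d (s j)] =
  \big[addb/false]_(j | j != i) [&& (i < j)%N, (s j < s i)%N, B & d (s j)].
  by apply: eq_bigr => j _; rewrite -!big_distrr -big_distrl /= -BE.
rewrite -/(koszul_exp t b) -/X.
set K := koszul_exp t b.
(* For [s] the block is one input of degree [q (+) B], for [u] its inputs have total degree [B]; for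
   each [j] the discrepancy is the term with [q]. *)
have : \big[addb/false]_(j | j != i)
   ([&& (j < i)%N, (s i < s j)%N, d (s j) & q (+) B] (+)
    [&& (i < j)%N, (s j < s i)%N, q (+) B & d (s j)] (+)
    (q && d (s j) && ((j < i) (+) (s j < s i))%N)) =
  \big[addb/false]_(j | j != i)
   ([&& (j < i)%N, (s i < s j)%N, d (s j) & B] (+)
    [&& (i < j)%N, (s j < s i)%N, B & d (s j)]).
  apply: eq_bigr => j ji; have := sinj j ji; move: ji.
  rewrite -!val_eqE /= !neq_ltn.
  by case: (ltngtP j i); case: (ltngtP (s j) (s i)) => // _ _ _ _;
    case: (d _) (q) (B) => [] [] [].
rewrite !big_split /= => E.
move: E; rewrite -/X.
by case: X K => [] []; do 5![case: (bigop.body _ _ _)].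
Qed.

(** On homogeneous arguments both sides are signed copies of one value of [x], and
    [koszul_exp_block] matches the signs. *)
Lemma endo_comp_act n m r p q e (i : 'I_n) (er : r.+1 = (n + m)%N)
    (es : e = p (+) q) (s : 'S_n) (t : 'S_m) (u : 'S_r)
    (x : endo W n p) (y : endo W m q) :
  block_perm i s t u ->
  endo_comp (s i) er es (endo_act s x) (endo_act t y) =
  endo_act u (endo_comp i er es x y).
Proof.
move=> hu; have [hm hn] := hu; apply: endo_ext => d v hv.
have xl := endo_mult x; have yl := endo_mult y.
have hvat := vat_homog _ hv.
pose b := [ffun l : 'I_m => qat d (s i + l)].
(* Degrees of the arguments handed to the permuted [x]; the output of [y] has the total degree of
   its inputs plus [q]. *)
pose c := [ffun j : 'I_n =>
  if j == s i then q (+) \big[addb/false]_l b l else qat d (outer m (s i) j)].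
set w := comp_arg (s i) q (endo_act t y) v.
have wc (j : 'I_n) : homog (c j) (w j).
  rewrite !ffunE -val_eqE /=; case: ltnP => ji.
    by rewrite (ltn_eqF ji) /outer ji; apply: homog_ksgn.
  case: eqP => _ //; apply: (endo_par (endo_act t y)) => l.
  by rewrite !ffunE.
pose vu := [ffun a => v (u a)].
rewrite [LHS](act_fun_homog _ xl wc).
rewrite [RHS](act_fun_homog _ (endo_mult (endo_comp i er es x y)) hv).
rewrite -/vu /= /comp_fun; set z := comp_arg i q y vu.
(* The sign exponent between the arguments [j] of the two sides: at [i] the Koszul sign of [t],
   elsewhere whether [y] crosses that argument on one side only. *)
pose g (j : 'I_n) : bool := if j == i then koszul_exp t b else
  q && c (s j) && ((j < i) (+) (s j < s i))%N.
have vuE (j : 'I_n) : j != i ->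
    vat vu (outer m i j) = vat v (outer m (s i) (s j)).
  move=> ji; have jr := ltn_outer er ji.
  rewrite -[outer m i j]/(val (Ordinal jr)) vat_ord ffunE -vat_ord.
  by rewrite (hn j).
have -> : [ffun j => w (s j)] = [ffun j => (-1) ^+ g j *: z j].
  apply/ffunP => j; rewrite [LHS]ffunE [RHS]ffunE /g.
  case: (eqVneq j i) => [->|ji].
    rewrite !ffunE !ltnn !eqxx.
    rewrite [LHS](act_fun_homog (e := b) _ yl) ?koszulE; last first.
      by move=> l; rewrite !ffunE.
    congr (_ *: y _); apply/ffunP => l; rewrite !ffunE.
    have lr : (i + l < r)%N by have := (ltn_ord i, ltn_ord l) => -[]; lia.
    rewrite -[(i + l)%N]/(val (Ordinal lr)) vat_ord ffunE -vat_ord.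
    by rewrite (hm l).
  have sji : s j != s i by rewrite (inj_eq perm_inj).
  have cE : c (s j) = qat d (outer m (s i) (s j)) by rewrite ffunE (negbTE sji).
  have hz : homog (c (s j)) (vat v (outer m (s i) (s j))) by rewrite cE.
  have -> : w (s j) =
      ksgn (q && (s j < s i)%N) (vat v (outer m (s i) (s j))).
    rewrite ffunE (negbTE sji) /outer; case: ltnP => _; rewrite ?andbT //.
    by rewrite andbF /ksgn scale1r; case: (vat _ _).
  have -> : z j = ksgn (q && (j < i)%N) (vat v (outer m (s i) (s j))).
    rewrite -vuE // ffunE (negbTE ji) /outer; case: ltnP => _; rewrite ?andbT //.
    by rewrite andbF /ksgn scale1r; case: (vat _ _).
  rewrite !(ksgn_homog _ hz) scalerA -signr_addb; congr (_ ^+ _ *: _).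
  by case: (q) (c _) (j < i)%N (s j < s i)%N => [] [] [] [].
rewrite multilinear_scale // prod_signr scalerA !koszulE -signr_addb.
congr (_ ^+ _ *: _); rewrite (bigD1 i) //= {1}/g eqxx addbA.
rewrite -(koszul_exp_block (q := q) (d := c) (b := b) er hu).
- congr (_ (+) _); apply: eq_bigr => j ji; by rewrite /g (negbTE ji).
- move=> j a ji aj; rewrite ffunE (inj_eq perm_inj) (negbTE ji) -(hn _ _ ji aj).
  by rewrite /qat valK.
- by move=> l a al; rewrite ffunE -(hm _ _ al) /qat valK.
- by rewrite ffunE eqxx.
Qed.

Lemma endo_op_axioms : operad_axioms (endo_op W).
Proof.
split=> /=.
- exact: endo_comp_linl.
- exact: endo_comp_linr.
- exact: endo_act_lin.
- exact: endo_act_1.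
- exact: endo_act_M.
- exact: endo_comp_seq.
- exact: endo_comp_par.
- exact: endo_comp_act.
Qed.
End EndoOperad.

(** * The operation [twist_delta] as an inner derivation *)

Section TwistDelta.
Variables (k : fieldType) (P : dgStruct k).
Hypothesis ax : operad_axioms P.

Lemma twist_delta_lin (m : P 1%N true) n p : linear (@twist_delta k P m n p).
Proof.
move=> c x y; rewrite /twist_delta (comp_linr ax).
under eq_bigr do rewrite (comp_linl ax).
rewrite big_split /= -scaler_sumr scalerBr scalerDr opprD !scalerA (mulrC _ c).
by rewrite addrACA.
Qed.

Lemma twist_delta_linl n p (z : P n p) :
  linear (fun m : P 1%N true => twist_delta m z).
Proof.
move=> c m m'; rewrite /twist_delta (comp_linl ax).
under eq_bigr do rewrite (comp_linr ax).
rewrite big_split /= -scaler_sumr scalerBr scalerDr opprD !scalerA (mulrC _ c).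
by rewrite addrACA.
Qed.

Lemma twist_delta_act (m : P 1%N true) n p (s : 'S_n) (x : P n p) :
  twist_delta m (op_act s x) = op_act s (twist_delta m x).
Proof.
rewrite /twist_delta (linB (act_lin ax s)) (linZ (act_lin ax s)).
rewrite (lin_sum (act_lin ax s)); congr (_ - _ *: _).
  (* Writing [m] as acted on by the identity makes equivariance of composition applicable, with [s]
     itself as block permutation. *)
  rewrite -{1}(act_1 ax m).
  rewrite -{1}[ord0 : 'I_1](perm1 ord0) (comp_act ax _ _ (u := s)) //.
  split=> [l a al|j]; last by rewrite ord1.
  by rewrite perm1 /=; congr (nat_of_ord (s _)); apply/val_inj.
rewrite (reindex_inj (@perm_inj _ s)) /=; apply: eq_bigr => i _.
rewrite -{1}(act_1 ax m) (comp_act ax _ _ (u := s)) //.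
split=> [l a|j a ji].
  by rewrite !ord1 !addn0 => al; congr (nat_of_ord (s _)); apply/val_inj.
have out1 (h h' : 'I_n) : h' != h -> outer 1 h h' = h'.
  by rewrite -val_eqE /outer /=; case: ltnP; lia.
rewrite !out1 ?(inj_eq perm_inj) // => aj.
by congr (nat_of_ord (s _)); apply/val_inj.
Qed.

(** Inserting [mu] at an input of the composite means inserting it at an input of [y] or at an input
    [j != i] of [x]. The right side has two more terms, with [mu] between [x] and [y]; they
    cancel. *)
Lemma twist_delta_comp (mu : P 1%N true) n m r p q s (i : 'I_n)
    (er : r.+1 = (n + m)%N) (es : s = p (+) q) (esl : ~~ s = ~~ p (+) q)
    (esr : ~~ s = p (+) ~~ q) (x : P n p) (y : P m q) :
  twist_delta mu (op_comp i er es x y) =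
  op_comp i er esl (twist_delta mu x) y +
  (-1) ^+ p *: op_comp i er esr x (twist_delta mu y).
Proof.
have Ll := comp_linl ax i er esl y; have Lr := comp_linr ax i er esr x.
rewrite /twist_delta (linB Ll) (linZ Ll) (lin_sum Ll).
rewrite (linB Lr) (linZ Lr) (lin_sum Lr).
rewrite (comp_seq ax (n := 1%N) (p := true) (i := ord0) (j := i) _ _ er esl er es
  (erefl _) (erefl _)) //.
(* Isolates [mu] at input [i] of [x], to cancel against [mu] at the output of [y]. *)
rewrite (bigD1 i) //=.
rewrite (comp_seq ax (m := 1%N) (q := true) (i := i) (j := ord0) _ _ _ _
  (erefl _) (erefl _) er esr) ?addn0 //.
rewrite (big_block (i := i) (m := m) (Gn := fun j => (-1) ^+ q *:
  op_comp i er esl (op_comp j (twist_arity n) (twist_degree p) x mu) y)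
  (Gm := fun l => op_comp i er esr x
    (op_comp l (twist_arity m) (twist_degree q) y mu)) _ er) /=; first last.
- move=> l a al.
  exact: (comp_seq ax).
(* [comp_par] needs ordered inputs: right of [i] it applies directly, left of [i] with [y] and [mu]
   exchanged, where the sign squares to 1. *)
- move=> j a ji aj; case: (ltngtP j i) => [lt_ji|lt_ij|/val_inj eji]; last first.
  + by rewrite eji eqxx in ji.
  + have := comp_par ax (i := i) (j := j) (h := a) (h' := i) er es
      (twist_arity r) (twist_degree s) (twist_arity n) (twist_degree p) er esl
      x y mu lt_ij aj (erefl _).
    by rewrite andbT.
  have := comp_par ax (i := j) (j := i) (h := i) (h' := a)
    (twist_arity n) (twist_degree p) er esl er es (twist_arity r)
    (twist_degree s) x mu y lt_ji.
  rewrite aj /outer lt_ji ltnNge ltnW //= addn1 => -> //.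
  by rewrite scalerA -signr_addb addbb scale1r.
have sE : (-1) ^+ s = (-1) ^+ (p (+) q) :> k by rewrite es.
rewrite sE -scaler_sumr !scalerBr !scalerDr !scalerA -!signr_addb -addbA.
by rewrite addbb addbF [X in _ = _ - X + _]addrC !opprD !addrA subrK.
Qed.
End TwistDelta.

(** * The universal property of O[m] *)

Section Lift.
Variables (k : fieldType) (O : dgOperad k) (Q : dgStruct k).
Hypothesis ax : operad_axioms Q.
Variable g : forall n p, O n p -> Q n p.
Hypothesis g_lin : forall n p, linear (@g n p).
Hypothesis g_comp : forall n m r p q s (i : 'I_n) (er : r.+1 = (n + m)%N)
  (es : s = p (+) q) (x : O n p) (y : O m q),
  g (op_comp i er es x y) = op_comp i er es (g x) (g y).
Hypothesis g_act : forall n p (s : 'S_n) (x : O n p),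
  g (op_act s x) = op_act s (g x).
Variable mu : Q 1%N true.

Fixpoint term_eval n p (x : term O n p) : Q n p :=
  match x in term _ n p return Q n p with
  | Tgen _ _ x => g x
  | Tm => mu
  | Tcomp _ _ _ _ _ _ i er es x y =>
      op_comp i er es (term_eval x) (term_eval y)
  | Tact _ _ s x => op_act s (term_eval x)
  | Tzero _ _ => 0
  | Tadd _ _ x y => term_eval x + term_eval y
  | Tscale _ _ c x => c *: term_eval x
  end.

(** Each rule generating [teq] is an identity valid in the operad [Q], or a compatibility of [g]
    with the operations of [O]. *)
Lemma term_eval_teq n p (x y : term O n p) :
  teq x y -> term_eval x = term_eval y.
Proof.
elim=> {n p x y} //=.
- by move=> n p x y z _ -> _ ->.
- by move=> n m r p q s i er es x x' y y' _ -> _ ->.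
- by move=> n p s x x' _ ->.
- by move=> n p x x' y y' _ -> _ ->.
- by move=> n p c x x' _ ->.
- by move=> n p x y z; rewrite addrA.
- by move=> n p x y; rewrite addrC.
- by move=> n p x; rewrite add0r.
- by move=> n p x; rewrite scaleN1r addNr.
- by move=> n p a b x; rewrite scalerA.
- by move=> n p x; rewrite scale1r.
- by move=> n p a x y; rewrite scalerDr.
- by move=> n p a b x; rewrite scalerDl.
- by move=> n m r p q s i er es c x x' y; rewrite (comp_linl ax).
- by move=> n m r p q s i er es c x y y'; rewrite (comp_linr ax).
- by move=> n p s c x y; rewrite (act_lin ax).
- by move=> n p x; rewrite (act_1 ax).
- by move=> n p s t x; rewrite (act_M ax).
- move=> n m l r1 r2 r p q t s1 s2 s i j h er1 es1 er es er2 es2 er' es' x y z.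
  exact: (comp_seq ax).
- move=> n m l r1 r2 r p q t s1 s2 s i j h h' er1 es1 er es er2 es2 er' es'.
  move=> x y z; exact: (comp_par ax).
- move=> n m r p q e i er es s t u x y; exact: (comp_act ax).
Qed.

Definition lift n p (x : free_op O n p) : Q n p := term_eval (rp x).

Lemma lift_fcl n p (t : term O n p) : lift (fcl t) = term_eval t.
Proof. exact/term_eval_teq/rp_cl. Qed.

Lemma lift_gen n p (x : O n p) : lift (free_gen x) = g x.
Proof. exact: lift_fcl. Qed.

Lemma lift_m : lift (free_m O) = mu.
Proof. exact: lift_fcl. Qed.

Lemma lift_lin n p : linear (@lift n p).
Proof.
move=> c x y; have [[t ->] [u ->]] := (fclP x, fclP y).
by rewrite fcl_scale fcl_add !lift_fcl.
Qed.

Lemma lift_comp n m r p q s (i : 'I_n) (er : r.+1 = (n + m)%N)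
    (es : s = p (+) q) (x : free_op O n p) (y : free_op O m q) :
  lift (op_comp i er es x y) = op_comp i er es (lift x) (lift y).
Proof.
have [[t ->] [u ->]] := (fclP x, fclP y).
by rewrite fcl_comp !lift_fcl.
Qed.

Lemma lift_act n p (s : 'S_n) (x : free_op O n p) :
  lift (op_act s x) = op_act s (lift x).
Proof. by have [t ->] := fclP x; rewrite fcl_act !lift_fcl. Qed.

(** O and [m] generate O[m], so induction on a representing term suffices. This is what recovers an
    algebra over [hat O] from its restriction to O and the image of [m]. *)
Lemma lift_uniq (phi : forall n p, free_op O n p -> Q n p) :
  (forall n p, linear (phi n p)) ->
  (forall n m r p q s (i : 'I_n) (er : r.+1 = (n + m)%N) (es : s = p (+) q)
     (x : free_op O n p) (y : free_op O m q),
     phi r s (op_comp i er es x y) = op_comp i er es (phi n p x) (phi m q y)) ->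
  (forall n p (s : 'S_n) (x : free_op O n p),
     phi n p (op_act s x) = op_act s (phi n p x)) ->
  (forall n p (x : O n p), phi n p (free_gen x) = g x) ->
  phi 1%N true (free_m O) = mu ->
  forall n p (x : free_op O n p), phi n p x = lift x.
Proof.
move=> pl pc pa pg pm n p x; have [t ->] := fclP x; rewrite lift_fcl.
elim: t => {n p x} [n p x||n m r p q s i er es x hx y hy|n p s x hx|n p
  |n p x hx y hy|n p c x hx] /=.
- exact: pg.
- exact: pm.
- by rewrite -fcl_comp pc hx hy.
- by rewrite -fcl_act pa hx.
- exact: (lin0 (pl n p)).
- by rewrite -fcl_add (linD (pl n p)) hx hy.
- by rewrite -fcl_scale (linZ (pl n p)) hx.
Qed.

Lemma lift_delta n p (x : free_op O n p) :
  lift (@twist_delta k (free_dg O) (free_m O) n p x) = twist_delta mu (lift x).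
Proof.
rewrite /twist_delta (linB (@lift_lin _ _)) (linZ (@lift_lin _ _)).
rewrite (lin_sum (@lift_lin _ _)) lift_comp lift_m.
by under eq_bigr do rewrite lift_comp lift_m.
Qed.

(** Both differentials are derivations, so comparing them on O and on [m] is enough; the second
    hypothesis matches the rule for [m] in [term_d]. *)
Lemma lift_d (E : Q 1%N true) n p (x : free_op O n p) :
  (forall n p (x : O n p), g (dg_d x) = twist_delta E (g x)) ->
  twist_delta E mu =
    - op_comp (ord0 : 'I_1) (erefl : 2 = (1 + 1)%N)
        (erefl : false = true (+) true) mu mu ->
  lift (free_d x) = twist_delta E (lift x).
Proof.
move=> gd Emu; have [t ->] := fclP x; rewrite free_dE lift_fcl.
have El n' p' := @twist_delta_lin _ _ ax E n' p'.
elim: t => {n p x} [n p x||n m r p q s i er es x hx y hy|n p s x hx|n p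
  |n p x hx y hy|n p c x hx] /=.
- by rewrite lift_gen gd.
- by rewrite (linN (@lift_lin _ _)) lift_comp lift_m.
- rewrite (linD (@lift_lin _ _)) (linZ (@lift_lin _ _)) !lift_comp !lift_fcl.
  by rewrite hx hy (twist_delta_comp ax _ _ _ _ (comp_degl es) (comp_degr es)).
- by rewrite lift_act hx (twist_delta_act ax).
- by rewrite (lin0 (@lift_lin _ _)) (lin0 (El _ _)).
- by rewrite (linD (@lift_lin _ _)) (linD (El _ _)) hx hy.
- by rewrite (linZ (@lift_lin _ _)) (linZ (El _ _)) hx.
Qed.
End Lift.

(** * Differentials as odd elements of arity one *)

Section EndoDifferential.
Variables (k : fieldType) (W : bool -> lmodType k).

Lemma diff_endo_subproof (D : differential W) :
  is_end true (fun v : {ffun 'I_1 -> tot W} => tot_d D (v ord0)).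
Proof.
apply/asboolP; split=> [i v c x y|q v hv].
  by rewrite !ffunE ord1 eqxx linearP.
by rewrite big_ord1; apply: homog_tot_d.
Qed.

Definition diff_endo (D : differential W) : endo W 1 true :=
  Endo (diff_endo_subproof D).

Lemma endo_eval_lin n p (v : {ffun 'I_n -> tot W}) :
  linear (fun f : endo W n p => f v).
Proof. by []. Qed.

(** Composing with [diff_endo D] at input [i] changes the arguments exactly as [d_arg i] does. The
    separate [D'] lets the derivations of several differentials be compared inside one dg
    structure. *)
Lemma endo_dE (D D' : differential W) n p (f : endo W n p) :
  endo_d D f = @twist_delta k (endo_dg D') (diff_endo D) n p f.
Proof.
apply/val_inj/funext => v; have L := @endo_eval_lin n (~~ p) v.
rewrite [RHS](linB L) [X in _ - X](linZ L) [X in _ *: X](lin_sum L).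
congr (_ - _ *: _).
  rewrite /= /comp_fun !ffunE /=; congr (tot_d _ (f _)).
  by apply/ffunP => j; rewrite ffunE vat_ord.
apply: eq_bigr => i _ /=; rewrite /comp_fun; congr (f _).
apply/ffunP => j; rewrite !ffunE -val_eqE /=.
case: ltngtP => [ji|ij|/val_inj ->].
- by rewrite vat_ord.
(* An inserted operation of arity one does not shift the later inputs. *)
- by rewrite /outer ltnNge (ltnW ij) /= addn1 vat_ord.
- by rewrite addn0 vat_ord.
Qed.

Lemma endo1E (f : endo W 1 true) (v : {ffun 'I_1 -> tot W}) :
  f v = f [ffun=> v ord0].
Proof. by congr (f _); apply/ffunP => i; rewrite ffunE ord1. Qed.

Lemma endo_comp11 (f h : endo W 1 true) (v : {ffun 'I_1 -> tot W}) :
  endo_comp (ord0 : 'I_1) (erefl : 2 = (1 + 1)%N)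
    (erefl : false = true (+) true) f h v = f [ffun=> h v].
Proof.
congr (f _); apply/ffunP => i; rewrite !ffunE ord1 /=; congr (h _).
by apply/ffunP => j; rewrite ffunE ord1 vat_ord.
Qed.

Lemma diff_endo_sq (D : differential W) :
  endo_comp (ord0 : 'I_1) (erefl : 2 = (1 + 1)%N)
    (erefl : false = true (+) true) (diff_endo D) (diff_endo D) = 0.
Proof.
apply/val_inj/funext => v; rewrite [LHS]endo_comp11 /= !ffunE.
case: (v ord0) => a b.
exact: congr2 (@diff_sq _ _ D false a) (@diff_sq _ _ D true b).
Qed.
End EndoDifferential.

(** * From a square-zero odd endomorphism of the parity reversion to a differential *)

Section PiDifferential.
Variables (k : fieldType) (V : bool -> lmodType k) (E : endo (pi_sp V) 1 true).
Hypothesis E_sq : endo_comp (ord0 : 'I_1) (erefl : 2 = (1 + 1)%N)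
    (erefl : false = true (+) true) E E = 0.

Let e (x : tot (pi_sp V)) : tot (pi_sp V) := E [ffun=> x].

Let e_lin : linear e.
Proof.
move=> c x y; have := endo_mult E ord0 [ffun=> 0] c x y; rewrite /= /e.
have u (z : tot (pi_sp V)) :
    upd [ffun=> 0] ord0 z = [ffun=> z] :> {ffun 'I_1 -> _}.
  by apply/ffunP => i; rewrite !ffunE ord1.
by rewrite !u.
Qed.

Let e_homog q x : homog q x -> homog (~~ q) (e x).
Proof.
move=> hx; have := @endo_par _ _ _ _ E [ffun=> q] [ffun=> x].
by rewrite big_ord1 ffunE; apply=> i; rewrite !ffunE.
Qed.

Let e_sq x : e (e x) = 0.
Proof.
have := congr1 (fun f : endo _ _ _ => f [ffun=> x]) E_sq.
by rewrite endo_comp11.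
Qed.

(** Inverts [pi_d]: parity reversion makes [V true] the even component of [tot (pi_sp V)], and the
    minus sign undoes the one in [pi_fun]. *)
Definition pi_diff_fun (p : bool) : V p -> V (~~ p) :=
  match p with
  | true => fun x => - (e (x, 0)).2
  | false => fun x => - (e (0, x)).1
  end.

Lemma pi_diff_lin p : linear (@pi_diff_fun p).
Proof.
case: p => c x y /=.
  have := e_lin c (x, 0) (y, 0).
  have -> : c *: (x, 0) + (y, 0) = (c *: x + y, 0) :> tot (pi_sp V).
    by congr pair; rewrite /= scaler0 addr0.
  by move=> ->; rewrite /= opprD scalerN.
have := e_lin c (0, x) (0, y).
have -> : c *: (0, x) + (0, y) = (0, c *: x + y) :> tot (pi_sp V).
  by congr pair; rewrite /= scaler0 addr0.
by move=> ->; rewrite /= opprD scalerN.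
Qed.

Let e_even (x : V true) : e (x, 0) = (0, (e (x, 0)).2).
Proof. by rewrite -[LHS](@e_homog false (x, 0)). Qed.

Let e_odd (x : V false) : e (0, x) = ((e (0, x)).1, 0).
Proof. by rewrite -[LHS](@e_homog true (0, x)). Qed.

Lemma pi_diff_sq p (x : V p) : pi_diff_fun (pi_diff_fun x) = 0.
Proof.
case: p x => x /=.
  (* Since [e] is odd, this vector is [- e (x, 0)], which [e] kills. *)
  have -> : (0, - (e (x, 0)).2) = - (0, (e (x, 0)).2) :> tot (pi_sp V).
    by congr pair; rewrite /= oppr0.
  by rewrite (linN e_lin) -e_even e_sq /= !oppr0.
have -> : (- (e (0, x)).1, 0) = - ((e (0, x)).1, 0) :> tot (pi_sp V).
  by congr pair; rewrite /= oppr0.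
by rewrite (linN e_lin) -e_odd e_sq /= !oppr0.
Qed.

Definition pi_diff : differential V := Differential pi_diff_lin pi_diff_sq.

(** An odd [e] has only the two components between opposite parities, so [pi_diff] keeps all of
    it. *)
Lemma diff_endo_pi_diff : diff_endo (pi_d pi_diff) = E.
Proof.
apply/val_inj/funext => v; rewrite /= [RHS]endo1E -/(e _).
case: (v ord0) => a b.
have -> : (a, b) = (a, 0) + (0, b) :> tot (pi_sp V).
  by congr pair; rewrite /= ?addr0 ?add0r.
rewrite (linD e_lin) e_even e_odd.
by congr pair; rewrite /= /pi_fun /= opprK ?addr0 ?add0r.
Qed.
End PiDifferential.

(** * Commutators of odd elements of arity one *)

Section ArityOne.
Variables (k : fieldType) (P : dgStruct k).
Hypothesis ax : operad_axioms P.

Definition comp11 (a b : P 1%N true) : P 1%N false :=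
  op_comp (ord0 : 'I_1) (erefl : 2 = (1 + 1)%N)
    (erefl : false = true (+) true) a b.

Lemma twist_delta11 (a b : P 1%N true) :
  twist_delta a b = comp11 a b + comp11 b a.
Proof.
rewrite /twist_delta big_ord1 scaleN1r opprK /comp11; congr (_ + _).
(* The composites differ only in their proofs of the arity and degree equations. *)
by congr op_comp; apply: eq_irrelevance.
Qed.

Lemma comp11B (a b : P 1%N true) :
  comp11 (a - b) (a - b) = comp11 a a - twist_delta a b + comp11 b b.
Proof.
rewrite twist_delta11 /comp11 (linB (comp_linl ax _ _ _ _)).
rewrite !(linB (comp_linr ax _ _ _ _)) opprB opprD !addrA.
by rewrite addrAC.
Qed.
End ArityOne.

(** * The two directions of the correspondence *)

Section Correspondence.
Variables (k : fieldType) (O : dgOperad k) (V : bool -> lmodType k).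
Variable d : differential V.
Let W := pi_sp V.
(** The graded operad under [endo_dg] is the same for all differentials, so structures over every
    [d'] are compared inside this one [Q]. *)
Let Q := endo_dg (pi_d d).
Let ax : operad_axioms Q := endo_op_axioms W.
Let delta (d' : differential V) : Q 1%N true := diff_endo (pi_d d').

Lemma endo_d_twist (d' : differential V) n p (x : endo W n p) :
  endo_d (pi_d d') x = @twist_delta k Q (delta d') n p x.
Proof. exact: endo_dE. Qed.

Lemma delta_sq (d' : differential V) : comp11 (delta d') (delta d') = 0.
Proof. exact: diff_endo_sq. Qed.

(** * From an algebra over [hat O] to a pair *)

Section Forward.
Variable f : alg_structure (hat O) d.

Definition alg_m : Q 1%N true := sval f 1%N true (hat_m O).

Let phi n p (x : free_op O n p) : Q n p := sval f n p x.

Let phi_lin n p : linear (@phi n p).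
Proof. exact: (map_lin (svalP f)). Qed.

Let phi_comp n m r p q s (i : 'I_n) (er : r.+1 = (n + m)%N) (es : s = p (+) q)
    (x : free_op O n p) (y : free_op O m q) :
  phi (op_comp i er es x y) = op_comp i er es (phi x) (phi y).
Proof. exact: (Defs.map_comp (svalP f)). Qed.

Let phi_act n p (s : 'S_n) (x : free_op O n p) :
  phi (op_act s x) = op_act s (phi x).
Proof. exact: (map_act (svalP f)). Qed.

Let phi_delta n p (x : free_op O n p) :
  phi (@twist_delta k (free_dg O) (free_m O) n p x) =
  twist_delta alg_m (phi x).
Proof.
rewrite /twist_delta (linB (@phi_lin _ _)) (linZ (@phi_lin _ _)).
rewrite (lin_sum (@phi_lin _ _)) phi_comp.
by under eq_bigr do rewrite phi_comp.
Qed.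

(** The twisted differential goes to the bracket with D and its twisting term to the bracket with
    mu; subtracting leaves the differential of O[m]. *)
Let phi_d n p (x : free_op O n p) :
  phi (free_d x) = twist_delta (delta d) (phi x) - twist_delta alg_m (phi x).
Proof.
have := @map_d _ _ _ _ (svalP f) n p x.
rewrite [RHS]endo_d_twist => <-; rewrite -phi_delta.
rewrite -[sval f n (~~ p) _]/(phi _) (linD (@phi_lin _ _)).
by rewrite addrK.
Qed.

(** [phi_d] at [m] reads - mu mu = [D, mu] - [mu, mu], and the last bracket is twice mu mu. *)
Lemma alg_m_mc : twist_delta (delta d) alg_m = comp11 alg_m alg_m.
Proof.
have := phi_d (free_m O); rewrite free_dE /= (linN (@phi_lin _ _)) phi_comp.
change (phi (free_m O)) with alg_m.
rewrite -[op_comp _ _ _ _ _]/(comp11 alg_m alg_m) => /esym/eqP.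
by rewrite subr_eq [X in _ + X]twist_delta11 addKr => /eqP.
Qed.

Lemma alg_sq : comp11 (delta d - alg_m) (delta d - alg_m) = 0.
Proof. by rewrite (comp11B ax) delta_sq alg_m_mc sub0r addNr. Qed.

Definition alg_diff : differential V := pi_diff alg_sq.

Lemma delta_alg_diff : delta alg_diff = delta d - alg_m.
Proof. exact: diff_endo_pi_diff. Qed.

Definition alg_res n p (x : O n p) : endo_dg (pi_d alg_diff) n p :=
  sval f n p (hat_gen x).

Lemma alg_res_map : dgop_map alg_res.
Proof.
split.
- move=> n p c x y; rewrite -(@phi_lin n p).
  by congr (phi _); rewrite fcl_scale fcl_add; apply/fcl_teq/teq_gen_lin.
- move=> n m r p q s i er es x y; rewrite -[RHS]phi_comp.
  by congr (phi _); rewrite fcl_comp; apply/fcl_teq/teq_gen_comp.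
- move=> n p s x; rewrite -[RHS]phi_act.
  by congr (phi _); rewrite fcl_act; apply/fcl_teq/teq_gen_act.
- move=> n p x; rewrite [RHS]endo_d_twist delta_alg_diff.
  rewrite (linB (twist_delta_linl ax _)) -phi_d.
  by congr (phi _); rewrite free_dE.
Qed.

Definition alg_forward : {d' : differential V & alg_structure O d'} :=
  existT _ alg_diff (exist _ alg_res alg_res_map).
End Forward.

(** * From a pair to an algebra over [hat O] *)

Section Backward.
Variables (d' : differential V) (g : alg_structure O d').

Let mu : Q 1%N true := delta d - delta d'.

Definition alg_lift n p (x : hat O n p) : Q n p :=
  @lift k O Q (sval g) mu n p x.

Lemma alg_lin n p : linear (sval g n p : O n p -> Q n p).
Proof. exact: (map_lin (svalP g)). Qed.

Lemma alg_comp n m r p q s (i : 'I_n) (er : r.+1 = (n + m)%N) (es : s = p (+) q)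
    (x : O n p) (y : O m q) :
  (sval g _ _ (op_comp i er es x y) : Q r s) =
  op_comp i er es (sval g _ _ x : Q n p) (sval g _ _ y : Q m q).
Proof. exact: (Defs.map_comp (svalP g)). Qed.

Lemma alg_act n p (s : 'S_n) (x : O n p) :
  (sval g _ _ (op_act s x) : Q n p) = op_act s (sval g _ _ x : Q n p).
Proof. exact: (map_act (svalP g)). Qed.

Lemma alg_lift_map : dgop_map alg_lift.
Proof.
split.
- exact: (@lift_lin k O Q ax _ alg_lin alg_comp alg_act mu).
- exact: (@lift_comp k O Q ax _ alg_lin alg_comp alg_act mu).
- exact: (@lift_act k O Q ax _ alg_lin alg_comp alg_act mu).
move=> n p x; rewrite [RHS]endo_d_twist.
have L := @lift_lin k O Q ax _ alg_lin alg_comp alg_act mu.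
rewrite [LHS](linD (L _ _)) (lift_delta ax alg_lin alg_comp alg_act).
rewrite (lift_d ax alg_lin alg_comp alg_act (E := delta d')).
(* [D', .] + [mu, .] = [D, .], because mu = D - D'. *)
- by rewrite -(linD (twist_delta_linl ax _)) addrC subrK.
- move=> n' p' y; rewrite -endo_d_twist.
  exact: (map_d (svalP g)).
(* As D and D' square to zero, both sides of the condition on [m] equal [D, D']. *)
rewrite -/(comp11 _ _) /mu (comp11B ax) !delta_sq sub0r addr0 opprK.
rewrite (linB (@twist_delta_lin _ _ ax _ _ _)) !twist_delta11 delta_sq addr0.
by rewrite subr0 addrC.
Qed.

Definition alg_backward : alg_structure (hat O) d :=
  exist _ alg_lift alg_lift_map.
End Backward.

(** * The two constructions are mutually inverse *)

Lemma delta_inj : injective delta.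
Proof.
move=> d1 d2 d12.
have d12E (x : tot W) : tot_d (pi_d d1) x = tot_d (pi_d d2) x.
  have := congr1 (fun h : endo W 1 true => h [ffun=> x]) d12.
  by rewrite /= ffunE.
have {d12E} d12E : diff_fun d1 = diff_fun d2.
  apply: functional_extensionality_dep => -[];
    apply/funext => x; apply: oppr_inj.
    exact: (congr1 snd (d12E (x, 0))).
  exact: (congr1 fst (d12E (0, x))).
(* Identifying the functions first puts the proof fields over a common function, where proof
   irrelevance applies. *)
case: d1 d2 d12 d12E => [f1 l1 s1] [f2 l2 s2] _ /= f12; case: f2 / f12 l2 s2.
by move=> l2 s2; congr Differential; apply: Prop_irrelevance.
Qed.

(** Values are compared in [endo W n p], whose type is independent of the differential, which avoids
    a transport between the second components. *)
Lemma alg_pair_eq (a b : {d' : differential V & alg_structure O d'}) :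
  delta (tag a) = delta (tag b) ->
  (forall n p (x : O n p),
     sval (tagged a) n p x = sval (tagged b) n p x :> endo W n p) -> a = b.
Proof.
case: a b => [d1 g1] [d2 g2] /= /delta_inj d12; case: d2 / d12 g2 => g2 g12.
congr existT; case: g1 g2 g12 => [g1 h1] [g2 h2] /= g12; apply: eq_exist.
do 2![apply: functional_extensionality_dep => ?]; apply/funext => x.
exact: g12.
Qed.

Lemma alg_backwardK (G : {d' : differential V & alg_structure O d'}) :
  alg_forward (alg_backward (tagged G)) = G.
Proof.
case: G => d' g; apply: alg_pair_eq => /= [|n p x].
  rewrite delta_alg_diff /alg_m /= /alg_lift.
  rewrite (lift_m ax (alg_lin g) (alg_comp g) (alg_act g)).
  by rewrite opprB addrC subrK.
exact: (lift_gen ax (alg_lin g) (alg_comp g) (alg_act g)).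
Qed.

Lemma alg_forwardK (f : alg_structure (hat O) d) :
  alg_backward (tagged (alg_forward f)) = f.
Proof.
case: f => f fP; apply: eq_exist.
do 2![apply: functional_extensionality_dep => ?]; apply/funext => x.
pose G := tagged (alg_forward (exist _ f fP)).
apply/esym/(lift_uniq ax (alg_lin G) (alg_comp G) (alg_act G)) => //.
- exact: (map_lin fP).
- exact: (Defs.map_comp fP).
- exact: (map_act fP).
(* Agreement on [m]: D - (D - mu) = mu. *)
by rewrite [X in _ - X]delta_alg_diff subKr.
Qed.
End Correspondence.

(** A bare bijection would only compare cardinalities; the formulas fix it as the change of
    differential by the image of [m] together with restriction to O. *)
Theorem proposition5p5 (k : fieldType) (k_char0 : [pchar k] =i pred0)
    (O : dgOperad k) (V : bool -> lmodType k) (d : differential V) :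
  exists F : alg_structure (hat O) d ->
             {d' : differential V & alg_structure O d'},
    bijective F /\
    forall f : alg_structure (hat O) d,
      (forall x : tot (pi_sp V),
         tot_d (pi_d (tag (F f))) x =
         tot_d (pi_d d) x -
         (sval f 1%N true (hat_m O) : endo (pi_sp V) 1 true) [ffun=> x]) /\
      (forall n p (x : O n p),
         sval (tagged (F f)) n p x = sval f n p (hat_gen x)
           :> endo (pi_sp V) n p).
Proof.

exists (@alg_forward k O V d); split.
  exact: (Bijective (@alg_forwardK k O V d) (@alg_backwardK k O V d)).
move=> f; split=> // x.
(* Evaluates [delta_alg_diff], an equation between elements of arity one, at the single argument
   [x]. *)
transitivity
  ((diff_endo (pi_d d) - alg_m f : endo (pi_sp V) 1 true) [ffun=> x]).
  by rewrite -[X in endo_fun X]delta_alg_diff /= ffunE.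
by rewrite (linB (endo_eval_lin _)) /= ffunE.
Qed.
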